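(* Let $R$ be a left Noetherian ring. The following two assertions are equivalent. (a) For every finitely generated left $R$-module $M$: if there is an integer $n$ with $\operatorname{Ext}_R^i(M,M)=0=\operatorname{Ext}_R^i(M,R)$ for all $i\geq n$, then $M$ has finite projective dimension. (b) For every object $M$ of $\mathsf{D}^b(R\text{-mod})$: if $M\perp M$ and $M\perp R$, then $M$ belongs to $\mathsf{Thick}(R)$.
   Context: $R\text{-mod}$ is the category of finitely generated left $R$-modules and $\mathsf{D}^b(R\text{-mod})$ is its bounded derived category, with shift functor $\Sigma$; $R$ is regarded as a stalk complex in degree $0$. For objects $X,Y$ of a triangulated category $\mathsf{T}$ with shift $\Sigma$, $X\perp Y$ (''eventually orthogonal'') means that $\operatorname{Hom}_{\mathsf{T}}(X,\Sigma^iY)=0$ for all integers $i$ with $|i|$ sufficiently large (vanishing is not required for all $i\in\mathbb{Z}$). A triangulated subcategory of $\mathsf{T}$ is a non-empty full subcategory closed under all shifts $\Sigma^i$, $i\in\mathbb{Z}$, and such that whenever two of the objects $X,Y,Z$ in a distinguished triangle $X\to Y\to Z\to\Sigma X$ lie in it, so does the third; it is thick if it is also closed under direct summands. $\mathsf{Thick}(R)$ is the intersection of all thick subcategories of $\mathsf{D}^b(R\text{-mod})$ containing $R$. *)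

(* Defs.v *)
From HB Require Import structures.
From mathcomp Require Import all_boot all_order all_algebra.
From mathcomp Require Import zify.

Set Implicit Arguments.
Unset Strict Implicit.
Unset Printing Implicit Defensive.

Import Order.TTheory GRing.Theory Num.Theory.
Local Open Scope ring_scope.

(* Rings are [pzRingType]s, so the zero ring is allowed.  An [lmodType R] is an
   arbitrary left R-module. *)

Definition left_ideal (R : pzRingType) (I : R -> Prop) : Prop :=
  I 0 /\ forall a x y : R, I x -> I y -> I (a * x + y).

Definition left_noetherian (R : pzRingType) : Prop :=
  forall I : R -> Prop, left_ideal I ->
  exists (n : nat) (g : 'I_n -> R),
    (forall k, I (g k)) /\
    (forall x, I x -> exists c : 'I_n -> R, x = \sum_(k < n) c k * g k).

Definition fin_gen (R : pzRingType) (M : lmodType R) : Prop :=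
  exists (n : nat) (g : 'I_n -> M),
    forall x : M, exists c : 'I_n -> R, x = \sum_(k < n) c k *: g k.

Definition surjective (A B : Type) (f : A -> B) : Prop :=
  forall b, exists a, f a = b.

Definition projective (R : pzRingType) (P : lmodType R) : Prop :=
  forall (A B : lmodType R) (g : {linear A -> B}) (f : {linear P -> B}),
    surjective g -> exists h : {linear P -> A}, forall x, g (h x) = f x.

Record proj_resolution (R : pzRingType) (M : lmodType R) := ProjResolution {
  res_ob : nat -> lmodType R;
  res_d : forall n, {linear res_ob n.+1 -> res_ob n};
  res_aug : {linear res_ob 0 -> M};
  res_proj : forall n, projective (res_ob n);
  res_aug_surj : surjective res_aug;
  res_exact0 : forall x, res_aug x = 0 <-> exists y, res_d 0 y = x;
  res_exact : forall n x, res_d n x = 0 <-> exists y, res_d n.+1 y = x }.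

Definition fin_proj_dim (R : pzRingType) (M : lmodType R) : Prop :=
  exists (P : proj_resolution M) (n : nat),
    forall k : nat, (n < k)%N -> forall x : res_ob P k, x = 0.

Definition Hom_cocycle (R : pzRingType) (M : lmodType R) (P : proj_resolution M)
    (N : lmodType R) (i : nat) (phi : {linear res_ob P i -> N}) : Prop :=
  forall x, phi (res_d P i x) = 0.

Definition Hom_coboundary (R : pzRingType) (M : lmodType R)
    (P : proj_resolution M) (N : lmodType R) (i : nat) :
    {linear res_ob P i -> N} -> Prop :=
  match i with
  | 0%N => fun phi => forall x, phi x = 0
  | k.+1 => fun phi =>
      exists psi : {linear res_ob P k -> N}, forall x, phi x = psi (res_d P k x)
  end.

(* Ext_R^i(M, N) = 0, with Ext_R^i(M, N) computed as H^i(Hom_R(P, N)) for a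
   projective resolution P of M; up to isomorphism it does not depend on P. *)
Definition Ext_zero (R : pzRingType) (i : nat) (M N : lmodType R) : Prop :=
  forall (P : proj_resolution M) (phi : {linear res_ob P i -> N}),
    Hom_cocycle phi -> Hom_coboundary phi.

(* The objects of D^b(R-mod): bounded cochain complexes of finitely generated
   left R-modules.  The differential is a family indexed by pairs (i, j), zero
   unless j = i + 1; this avoids casts between X (i + 1 + n) and X (i + n + 1)
   in the definition of shifts. *)
Record bcomplex (R : pzRingType) := BComplex {
  ob :> int -> lmodType R;
  dif : forall i j : int, {linear ob i -> ob j};
  dif_shape : forall i j, j != i + 1 -> forall x, dif i j x = 0;
  dif_dif : forall i j k x, dif j k (dif i j x) = 0;
  ob_fin_gen : forall i, fin_gen (ob i);
  ob_bounded : exists n : nat, forall i : int, (n < `|i|)%N ->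
    forall x : ob i, x = 0 }.

Record chain_map (R : pzRingType) (X Y : bcomplex R) := ChainMap {
  cmap :> forall i : int, {linear X i -> Y i};
  cmap_dif : forall i j x, cmap j (dif X i j x) = dif Y i j (cmap i x) }.

Definition homotopic (R : pzRingType) (X Y : bcomplex R)
    (f g : chain_map X Y) : Prop :=
  exists h : forall i j : int, {linear X i -> Y j},
    forall i x, f i x - g i x =
      dif Y (i - 1) i (h i (i - 1) x) + h (i + 1) i (dif X i (i + 1) x).

Definition cocycle (R : pzRingType) (X : bcomplex R) (i : int) (x : X i) : Prop :=
  forall j, dif X i j x = 0.

Definition coboundary (R : pzRingType) (X : bcomplex R) (i : int) (x : X i) :
    Prop :=
  exists j (y : X j), dif X j i y = x.

(* The two conjuncts are injectivity and surjectivity of H^i(X) -> H^i(Y). *)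
Definition quasi_iso (R : pzRingType) (X Y : bcomplex R) (f : chain_map X Y) :
    Prop :=
  forall i,
    (forall x : X i, cocycle x -> coboundary (f i x) -> coboundary x) /\
    (forall y : Y i, cocycle y ->
       exists x : X i, cocycle x /\ coboundary (y - f i x)).

Lemma id_map_dif (R : pzRingType) (X : bcomplex R) i j (x : X i) :
  (idfun : {linear X j -> X j}) (dif X i j x) =
  dif X i j ((idfun : {linear X i -> X i}) x).
Proof. by []. Qed.

Definition id_map (R : pzRingType) (X : bcomplex R) : chain_map X X :=
  ChainMap (@id_map_dif R X).

Lemma zero_map_dif (R : pzRingType) (X Y : bcomplex R) i j (x : X i) :
  (\0 : {linear X j -> Y j}) (dif X i j x) =
  dif Y i j ((\0 : {linear X i -> Y i}) x).
Proof. by rewrite /= linear0. Qed.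

Definition zero_map (R : pzRingType) (X Y : bcomplex R) : chain_map X Y :=
  ChainMap (@zero_map_dif R X Y).

Lemma comp_map_dif (R : pzRingType) (X Y Z : bcomplex R)
    (g : chain_map Y Z) (f : chain_map X Y) i j (x : X i) :
  (g j \o f j : {linear X j -> Z j}) (dif X i j x) =
  dif Z i j ((g i \o f i : {linear X i -> Z i}) x).
Proof. by rewrite /= !cmap_dif. Qed.

Definition comp_map (R : pzRingType) (X Y Z : bcomplex R)
    (g : chain_map Y Z) (f : chain_map X Y) : chain_map X Z :=
  ChainMap (comp_map_dif g f).

Lemma quasi_iso_id (R : pzRingType) (X : bcomplex R) : quasi_iso (id_map X).
Proof.
move=> i; split=> // y cy; exists y; split=> //=.
by exists i, 0; rewrite subrr linear0.
Qed.

(* A morphism X -> Y of D^b(R-mod), the localization of the homotopy category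
   K^b(R-mod) at the quasi-isomorphisms, is a class of roofs X <-- Z --> Y for
   the relation [roof_eq]. *)
Record roof (R : pzRingType) (X Y : bcomplex R) := Roof {
  apex : bcomplex R;
  back : chain_map apex X;
  front : chain_map apex Y;
  back_qis : quasi_iso back }.

Definition roof_eq (R : pzRingType) (X Y : bcomplex R) (u v : roof X Y) : Prop :=
  exists (W : bcomplex R) (s : chain_map W (apex u)) (t : chain_map W (apex v)),
    [/\ quasi_iso (comp_map (back u) s),
        homotopic (comp_map (back u) s) (comp_map (back v) t) &
        homotopic (comp_map (front u) s) (comp_map (front v) t)].

Definition roof_of (R : pzRingType) (X Y : bcomplex R) (f : chain_map X Y) :
    roof X Y :=
  Roof f (@quasi_iso_id R X).

(* [is_comp u v w]: w is the composite of u followed by v, i.e. it is the class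
   of the outer roof X <-- W --> Z for a square completing u and v
   (all such completions give the same class). *)
Definition is_comp (R : pzRingType) (X Y Z : bcomplex R)
    (u : roof X Y) (v : roof Y Z) (w : roof X Z) : Prop :=
  exists (W : bcomplex R) (s : chain_map W (apex u)) (g : chain_map W (apex v))
         (q : quasi_iso (comp_map (back u) s)),
    homotopic (comp_map (front u) s) (comp_map (back v) g) /\
    roof_eq w (Roof (comp_map (front v) g) q).

Definition commutes (R : pzRingType) (X Y X' Y' : bcomplex R)
    (u : roof X Y) (b : roof Y Y') (a : roof X X') (u' : roof X' Y') : Prop :=
  exists w : roof X Y', is_comp u b w /\ is_comp a u' w.

Definition is_iso (R : pzRingType) (X Y : bcomplex R) (u : roof X Y) : Prop :=
  exists v : roof Y X,
    is_comp u v (roof_of (id_map X)) /\ is_comp v u (roof_of (id_map Y)).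

Definition shift_dif (R : pzRingType) (n : int) (X : bcomplex R) (i j : int) :
    {linear X (i + n) -> X (j + n)} :=
  if odd `|n|%N
  then (\- dif X (i + n) (j + n) : {linear X (i + n) -> X (j + n)})
  else (dif X (i + n) (j + n) : {linear X (i + n) -> X (j + n)}).

Lemma shift_difE (R : pzRingType) (n : int) (X : bcomplex R) (i j : int) x :
  shift_dif n X i j x = (-1) ^+ `|n|%N *: dif X (i + n) (j + n) x.
Proof. by rewrite -signr_odd /shift_dif; case: odd; rewrite ?scaleN1r ?scale1r. Qed.

Lemma shift_dif_shape (R : pzRingType) (n : int) (X : bcomplex R) i j :
  j != i + 1 -> forall x, shift_dif n X i j x = 0.
Proof.
move=> ij x; rewrite shift_difE dif_shape ?scaler0 //.
by apply: contra ij => /eqP ij; apply/eqP/(addIr n); rewrite ij addrAC.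
Qed.

Lemma shift_dif_dif (R : pzRingType) (n : int) (X : bcomplex R) i j k x :
  shift_dif n X j k (shift_dif n X i j x) = 0.
Proof. by rewrite !shift_difE linearZ /= dif_dif !scaler0. Qed.

Lemma shift_bounded (R : pzRingType) (n : int) (X : bcomplex R) :
  exists m : nat, forall i : int, (m < `|i|)%N -> forall x : X (i + n), x = 0.
Proof.
have [m hm] := ob_bounded X; exists (m + `|n|)%N => i hi; apply: hm; lia.
Qed.

(* The shifted complex: (Sigma^n X)^i = X^(i+n), with differential (-1)^n d. *)
Definition cshift (R : pzRingType) (n : int) (X : bcomplex R) : bcomplex R :=
  @BComplex R (fun i => X (i + n)) (shift_dif n X) (@shift_dif_shape R n X)
    (@shift_dif_dif R n X) (fun i => ob_fin_gen X (i + n)) (shift_bounded n X).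

Lemma shift_map_dif (R : pzRingType) (n : int) (X Y : bcomplex R)
    (f : chain_map X Y) i j (x : X (i + n)) :
  f (j + n) (dif (cshift n X) i j x) = dif (cshift n Y) i j (f (i + n) x).
Proof. by rewrite /= !shift_difE linearZ /= cmap_dif. Qed.

Definition shift_map (R : pzRingType) (n : int) (X Y : bcomplex R)
    (f : chain_map X Y) : chain_map (cshift n X) (cshift n Y) :=
  @ChainMap R (cshift n X) (cshift n Y) (fun i => f (i + n))
    (@shift_map_dif R n X Y f).

Lemma cocycle_shift (R : pzRingType) (n : int) (X : bcomplex R) i (x : X (i + n)) :
  @cocycle R (cshift n X) i x <-> cocycle x.
Proof.
split=> cx j.
  have := cx (j - n); rewrite /= shift_difE => /(congr1 ( *:%R ((-1) ^+ `|n|%N))).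
  by rewrite scaler0 scalerA -expr2 sqrr_sign scale1r subrK.
by rewrite /= shift_difE cx scaler0.
Qed.

Lemma coboundary_shift (R : pzRingType) (n : int) (X : bcomplex R) i
    (x : X (i + n)) :
  @coboundary R (cshift n X) i x <-> coboundary x.
Proof.
split=> [[j [y <-]]|[j]].
  by exists (j + n), ((-1) ^+ `|n|%N *: y); rewrite linearZ /= shift_difE.
rewrite -(subrK n j) => -[y <-]; exists (j - n), ((-1) ^+ `|n|%N *: y).
by rewrite linearZ /= shift_difE scalerA -expr2 sqrr_sign scale1r.
Qed.

Lemma quasi_iso_shift (R : pzRingType) (n : int) (X Y : bcomplex R)
    (f : chain_map X Y) : quasi_iso f -> quasi_iso (shift_map n f).
Proof.
move=> qf i; have [inj_f surj_f] := qf (i + n); split=> [x|y].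
  by move=> /cocycle_shift cx /coboundary_shift bx; apply/coboundary_shift/inj_f.
move=> /cocycle_shift cy; have [x [cx bx]] := surj_f y cy.
by exists x; split; [apply/cocycle_shift | apply/coboundary_shift].
Qed.

Definition roof_shift (R : pzRingType) (n : int) (X Y : bcomplex R)
    (u : roof X Y) : roof (cshift n X) (cshift n Y) :=
  Roof (shift_map n (front u)) (quasi_iso_shift n (@back_qis R X Y u)).

(* The identification of X i with X j when i = j, and 0 when i != j. *)
Definition transport (R : pzRingType) (X : int -> lmodType R) (i j : int)
    (x : X i) : X j :=
  match i =P j with
  | ReflectT e => ecast k (X k) e x
  | ReflectF _ => 0
  end.
Arguments transport {R} X {i} j x.

Lemma transport_id (R : pzRingType) (X : int -> lmodType R) i (x : X i) :
  transport X i x = x.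
Proof. by rewrite /transport; case: eqP => // e; rewrite eq_axiomK. Qed.

Lemma transport0 (R : pzRingType) (X : int -> lmodType R) i j (x : X i) :
  i != j -> transport X j x = 0.
Proof. by rewrite /transport; case: eqP. Qed.

Lemma transport_linear (R : pzRingType) (X : int -> lmodType R) i j :
  linear (@transport R X i j).
Proof.
move=> a x y; case: (eqVneq i j) => [<-|ij]; first by rewrite !transport_id.
by rewrite !transport0 // scaler0 addr0.
Qed.

HB.instance Definition _ (R : pzRingType) (X : int -> lmodType R) i j :=
  GRing.isLinear.Build R (X i) (X j) *:%R (@transport R X i j)
    (@transport_linear R X i j).

(* cone(f)^i = X^(i+1) x Y^i with differential (x, y) |-> (- d x, f x + d y);
   the transport places f x in Y^j when j = i + 1. *)
Definition cone_dif (R : pzRingType) (X Y : bcomplex R) (f : chain_map X Y)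
    (i j : int) (p : X (i + 1) * Y i) : X (j + 1) * Y j :=
  (- dif X (i + 1) (j + 1) p.1,
   transport Y j (f (i + 1) p.1) + dif Y i j p.2).

Lemma cone_dif_linear (R : pzRingType) (X Y : bcomplex R) (f : chain_map X Y)
    i j : linear (@cone_dif R X Y f i j).
Proof.
move=> a p q; rewrite /cone_dif /= !linearP /=.
congr (_, _); by rewrite /= scalerDr addrACA.
Qed.

HB.instance Definition _ (R : pzRingType) (X Y : bcomplex R)
    (f : chain_map X Y) i j :=
  GRing.isLinear.Build R (X (i + 1)%R * Y i)%type (X (j + 1)%R * Y j)%type *:%R
    (@cone_dif R X Y f i j) (@cone_dif_linear R X Y f i j).

Lemma cone_dif_shape (R : pzRingType) (X Y : bcomplex R) (f : chain_map X Y)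
    i j : j != i + 1 -> forall p, @cone_dif R X Y f i j p = 0.
Proof.
move=> ij p; rewrite /cone_dif !dif_shape ?(inj_eq (addIr 1)) //.
by rewrite transport0 1?eq_sym // oppr0 addr0.
Qed.

Lemma cone_dif_dif (R : pzRingType) (X Y : bcomplex R) (f : chain_map X Y)
    i j k p : @cone_dif R X Y f j k (@cone_dif R X Y f i j p) = 0.
Proof.
case: (eqVneq j (i + 1)) => [->|ij]; last by rewrite (cone_dif_shape f ij) linear0.
case: (eqVneq k (i + 1 + 1)) => [->|jk]; last by rewrite cone_dif_shape.
rewrite /cone_dif /= !transport_id !linearN /= dif_dif !oppr0.
by rewrite linearD /= dif_dif addr0 cmap_dif addNr.
Qed.

Lemma fin_gen_prod (R : pzRingType) (M N : lmodType R) :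
  fin_gen M -> fin_gen N -> fin_gen (M * N)%type.
Proof.
move=> [m [g hg]] [n [h hh]]; exists (m + n)%N.
exists (fun k => match split k with inl a => (g a, 0) | inr b => (0, h b) end).
move=> [x y]; have [c ->] := hg x; have [e ->] := hh y.
exists (fun k => match split k with inl a => c a | inr b => e b end).
rewrite big_split_ord /=.
have splitl (a : 'I_m) : split (lshift n a) = inl a := unsplitK (inl a).
have splitr (b : 'I_n) : split (rshift m b) = inr b := unsplitK (inr b).
under [X in _ = X + _]eq_bigr => a _ do rewrite splitl.
under [X in _ = _ + X]eq_bigr => b _ do rewrite splitr.
apply/eqP; rewrite -pair_eqE /=; apply/andP; split; apply/eqP.
  by rewrite !(raddf_sum fst) /= [X in _ + X]big1 ?addr0 // => b _; rewrite scaler0.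
by rewrite !(raddf_sum snd) /= [X in X + _]big1 ?add0r // => b _; rewrite scaler0.
Qed.

Lemma cone_bounded (R : pzRingType) (X Y : bcomplex R) :
  exists n : nat, forall i : int, (n < `|i|)%N ->
    forall p : X (i + 1) * Y i, p = 0.
Proof.
have [m hm] := ob_bounded X; have [n hn] := ob_bounded Y.
exists (m + n + 1)%N => i hi [x y].
by rewrite (hm (i + 1) _ x) ?(hn i _ y) //; lia.
Qed.

Definition cone (R : pzRingType) (X Y : bcomplex R) (f : chain_map X Y) :
    bcomplex R :=
  @BComplex R (fun i => (X (i + 1)%R * Y i)%type)
    (fun i j => @cone_dif R X Y f i j)
    (@cone_dif_shape R X Y f) (@cone_dif_dif R X Y f)
    (fun i => fin_gen_prod (ob_fin_gen X (i + 1)) (ob_fin_gen Y i))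
    (cone_bounded X Y).

Definition cone_in_fun (R : pzRingType) (X Y : bcomplex R) (f : chain_map X Y)
    (i : int) (y : Y i) : cone f i := (0, y).

Lemma cone_in_linear (R : pzRingType) (X Y : bcomplex R) (f : chain_map X Y) i :
  linear (@cone_in_fun R X Y f i).
Proof.
by move=> a x y; congr (_, _); rewrite /= ?scaler0 ?addr0.
Qed.

HB.instance Definition _ (R : pzRingType) (X Y : bcomplex R)
    (f : chain_map X Y) i :=
  GRing.isLinear.Build R (Y i) (cone f i) *:%R (@cone_in_fun R X Y f i)
    (@cone_in_linear R X Y f i).

Lemma cone_in_dif (R : pzRingType) (X Y : bcomplex R) (f : chain_map X Y)
    i j (y : Y i) :
  cone_in_fun f (dif Y i j y) = dif (cone f) i j (cone_in_fun f y).
Proof. by rewrite /= /cone_dif /cone_in_fun /= !linear0 add0r. Qed.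

Definition cone_in (R : pzRingType) (X Y : bcomplex R) (f : chain_map X Y) :
    chain_map Y (cone f) :=
  @ChainMap R Y (cone f) (fun i => @cone_in_fun R X Y f i) (@cone_in_dif R X Y f).

Lemma cone_out_dif (R : pzRingType) (X Y : bcomplex R) (f : chain_map X Y)
    (i j : int) (p : X (i + 1) * Y i) :
  (fst : {linear (X (j + 1)%R * Y j)%type -> X (j + 1)}) (dif (cone f) i j p) =
  dif (cshift 1 X) i j
    ((fst : {linear (X (i + 1)%R * Y i)%type -> X (i + 1)}) p).
Proof. by []. Qed.

Definition cone_out (R : pzRingType) (X Y : bcomplex R) (f : chain_map X Y) :
    chain_map (cone f) (cshift 1 X) :=
  @ChainMap R (cone f) (cshift 1 X) (fun i => fst) (@cone_out_dif R X Y f).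

(* X -u-> Y -v-> Z -w-> Sigma X is isomorphic in D^b(R-mod) to
   X' -f-> Y' -> cone(f) -> Sigma X' for some chain map f. *)
Definition distinguished (R : pzRingType) (X Y Z : bcomplex R)
    (u : roof X Y) (v : roof Y Z) (w : roof Z (cshift 1 X)) : Prop :=
  exists (X' Y' : bcomplex R) (f : chain_map X' Y')
         (a : roof X X') (b : roof Y Y') (c : roof Z (cone f)),
    [/\ is_iso a, is_iso b & is_iso c] /\
    [/\ commutes u b a (roof_of f),
        commutes v c b (roof_of (cone_in f)) &
        commutes w (roof_shift 1 a) c (roof_of (cone_out f))].

Definition sum_dif (R : pzRingType) (X Y : bcomplex R) (i j : int)
    (p : X i * Y i) : X j * Y j := (dif X i j p.1, dif Y i j p.2).

Lemma sum_dif_linear (R : pzRingType) (X Y : bcomplex R) i j :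
  linear (@sum_dif R X Y i j).
Proof. by move=> a p q; rewrite /sum_dif /= !linearP. Qed.

HB.instance Definition _ (R : pzRingType) (X Y : bcomplex R) i j :=
  GRing.isLinear.Build R (X i * Y i)%type (X j * Y j)%type *:%R
    (@sum_dif R X Y i j) (@sum_dif_linear R X Y i j).

Lemma sum_dif_shape (R : pzRingType) (X Y : bcomplex R) i j :
  j != i + 1 -> forall p, @sum_dif R X Y i j p = 0.
Proof. by move=> ij p; rewrite /sum_dif !dif_shape. Qed.

Lemma sum_dif_dif (R : pzRingType) (X Y : bcomplex R) i j k p :
  @sum_dif R X Y j k (@sum_dif R X Y i j p) = 0.
Proof. by rewrite /sum_dif /= !dif_dif. Qed.

Lemma sum_bounded (R : pzRingType) (X Y : bcomplex R) :
  exists n : nat, forall i : int, (n < `|i|)%N -> forall p : X i * Y i, p = 0.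
Proof.
have [m hm] := ob_bounded X; have [n hn] := ob_bounded Y.
exists (m + n)%N => i hi [x y].
by rewrite (hm i _ x) ?(hn i _ y) //; lia.
Qed.

Definition direct_sum (R : pzRingType) (X Y : bcomplex R) : bcomplex R :=
  @BComplex R (fun i => (X i * Y i)%type) (fun i j => @sum_dif R X Y i j)
    (@sum_dif_shape R X Y) (@sum_dif_dif R X Y)
    (fun i => fin_gen_prod (ob_fin_gen X i) (ob_fin_gen Y i)) (sum_bounded X Y).

Definition direct_summand (R : pzRingType) (Y X : bcomplex R) : Prop :=
  exists (Y' : bcomplex R) (u : roof X (direct_sum Y Y')), is_iso u.

(* A full subcategory is given by its class of objects. *)
Record thick (R : pzRingType) (S : bcomplex R -> Prop) : Prop := BuildThick {
  thick_nonempty : exists X, S X;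
  thick_shift : forall (n : int) X, S X -> S (cshift n X);
  thick_triangle : forall (X Y Z : bcomplex R)
    (u : roof X Y) (v : roof Y Z) (w : roof Z (cshift 1 X)),
    distinguished u v w ->
    [/\ S X -> S Y -> S Z, S Y -> S Z -> S X & S X -> S Z -> S Y];
  thick_summand : forall X Y, direct_summand Y X -> S X -> S Y }.

Definition Thick (R : pzRingType) (G X : bcomplex R) : Prop :=
  forall S : bcomplex R -> Prop, thick S -> S G -> S X.

Definition Hom_zero (R : pzRingType) (X Y : bcomplex R) : Prop :=
  forall u : roof X Y, roof_eq u (roof_of (zero_map X Y)).

Definition eventually_orthogonal (R : pzRingType) (X Y : bcomplex R) : Prop :=
  exists n : nat, forall i : int, (n <= `|i|)%N -> Hom_zero X (cshift i Y).

Definition stalk_ob (R : pzRingType) (M : lmodType R) (i : int) : lmodType R :=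
  if i == 0 then M else 'rV[R]_0.

Lemma stalk_fin_gen (R : pzRingType) (M : lmodType R) :
  fin_gen M -> forall i, fin_gen (stalk_ob M i).
Proof.
move=> fgM i; rewrite /stalk_ob; case: ifP => // _.
exists 0%N, (fun=> 0) => x; exists (fun=> 0); rewrite big_ord0.
by apply/rowP => -[].
Qed.

Lemma stalk_bounded (R : pzRingType) (M : lmodType R) :
  exists n : nat, forall i : int, (n < `|i|)%N -> forall x : stalk_ob M i, x = 0.
Proof.
exists 0%N => i hi; rewrite /stalk_ob; case: ifP => [i0 | _ x]; first lia.
by apply/rowP => -[].
Qed.

Definition stalk (R : pzRingType) (M : lmodType R) (fgM : fin_gen M) :
    bcomplex R :=
  @BComplex R (stalk_ob M) (fun i j => \0) (fun _ _ _ _ => erefl)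
    (fun _ _ _ _ => erefl) (stalk_fin_gen fgM) (stalk_bounded M).

Lemma fin_gen_regular (R : pzRingType) : fin_gen (R^o : lmodType R).
Proof.
exists 1%N, (fun=> 1) => x; exists (fun=> x).
by rewrite big_ord1 /GRing.scale /= mulr1.
Qed.

Definition stalk_ring (R : pzRingType) : bcomplex R := stalk (fin_gen_regular R).

(* Main.v *)
Require Import Defs.
From HB Require Import structures.
From mathcomp Require Import all_boot all_order all_algebra.
From mathcomp Require Import boolp.
From mathcomp Require Import zify.
Import Order.TTheory GRing.Theory Num.Theory.
Local Open Scope ring_scope.

Set Implicit Arguments.
Unset Strict Implicit.
Unset Printing Implicit Defensive.

(* Every bounded complex X has a resolution q : F -> X by a bounded above complex
   of finitely generated projectives, and Hom(X, Y) = 0 in D^b if and only if all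
   chain maps F -> Y are null-homotopic, since such maps factor through a bounded
   truncation of F.  In particular Hom(X, Sigma^(-i) N) = 0, for a module N, means
   that the complex Hom(F, N) is exact at Hom(F^i, N).

   (b) => (a): the X such that, for some n, Hom(X, Sigma^(-i) N) = 0 for all
   i <= n and all finitely generated N form a thick subcategory containing R.
   If it contains M, then Hom(F, Z) is exact far to the left for the syzygies Z
   of M, so that some syzygy is a retract of a projective.

   (a) => (b): let W = (N -> F^(a+1) -> F^(a+2) -> ...) be a truncation of F
   quasi-isomorphic to M.  As M is eventually orthogonal to R, a cocycle
   F^i -> N with i << 0 extends degree by degree to a chain map from F to a shift
   of W.  As M is eventually orthogonal to M, that map is null-homotopic, and
   since W vanishes below N the cocycle is a coboundary.  Hence N satisfies the
   hypothesis of (a), and has finite projective dimension.  Truncating F further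
   to the left then gives a bounded complex of finitely generated projectives,
   which lies in Thick(R). *)

(** * Submodules, Noetherian rings and projective modules *)

(** A resolution F is in general unbounded below, so it is not an object of D^b(R-mod) and cannot
    occur in a roof. It lives in the larger type [cpx]; only its truncations enter roofs. Thickness
    in (b) => (a) is checked on explicit resolutions of shifts, sums and cones. A lift of a chain
    map to resolutions must then commute strictly with the augmentations, not only up to homotopy,
    in order to induce a map of cones; this shapes the choice of resolutions. In (a) => (b) the
    module N need not be projective, but every term of W above it is. This is why vanishing against
    R alone controls the obstructions to extending a cocycle with values in N. *)

Section Submodules.
Variables (R : pzRingType) (M : lmodType R).

Definition submodule (P : M -> Prop) : Prop :=
  P 0 /\ forall a x y, P x -> P y -> P (a *: x + y).

Variables (P : M -> Prop) (hP : submodule P).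

(** The proof of [submodule P] is a parameter so that unification finds it when the submodule
    structure of [sub] is inferred. *)
Definition sub_pred & submodule P : {pred M} := fun x => `[< P x >].

Lemma sub_pred_closed : submod_closed (sub_pred hP).
Proof.
case: (hP) => P0 PD; split; first exact/asboolP.
by move=> a x y /asboolP Px /asboolP Py; apply/asboolP/PD.
Qed.
HB.instance Definition _ :=
  GRing.isSubmodClosed.Build R M (sub_pred hP) sub_pred_closed.

Record sub := Sub_ { sval_ :> M; _ : sval_ \in sub_pred hP }.
HB.instance Definition _ := [isSub for sval_].
HB.instance Definition _ := [Choice of sub by <:].
HB.instance Definition _ := [SubChoice_isSubLmodule of sub by <:].

(* Sealed, so that simplification does not unfold the inclusion. *)
Fact incl_key : {f : {linear sub -> M} | forall x, f x = val x}.
Proof. by exists val. Qed.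
Definition incl := sval incl_key.

Lemma incl_inj : injective incl.
Proof. by move=> x y; rewrite /incl !(svalP incl_key) => /val_inj. Qed.

Lemma inclP (x : sub) : P (incl x).
Proof. by rewrite /incl (svalP incl_key); apply/asboolP; case: x. Qed.

Lemma incl_ex x : P x -> exists y : sub, incl y = x.
Proof.
by move=> Px; exists (Sub_ (asboolT Px)); rewrite /incl (svalP incl_key).
Qed.

End Submodules.

Lemma exists_linear (R : pzRingType) (A B : lmodType R) (f : A -> B) :
  linear f -> exists g : {linear A -> B}, forall x, g x = f x.
Proof.
move=> lf; pose G := GRing.isLinear.Build R A B *:%R f lf.
by exists (HB.pack f G : {linear A -> B}).
Qed.

Lemma sub_factor (R : pzRingType) (M : lmodType R) (P : M -> Prop)
    (hP : submodule P) (A : lmodType R) (f : {linear A -> M}) :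
  (forall x, P (f x)) ->
  exists g : {linear A -> sub hP}, forall x, incl hP (g x) = f x.
Proof.
move=> Pf; have /choice [g gE] := fun x => incl_ex hP (Pf x).
have [|h hE] := @exists_linear R A (sub hP) g; last by exists h => x; rewrite hE.
by move=> a x y; apply: (@incl_inj _ _ _ hP); rewrite linearP !gE linearP.
Qed.

Lemma submodule0 (R : pzRingType) (M : lmodType R) : submodule (fun x : M => x = 0).
Proof. by split=> // a x y -> ->; rewrite scaler0 addr0. Qed.

Lemma submodule_ker (R : pzRingType) (M N : lmodType R) (f : {linear M -> N}) :
  submodule (fun x => f x = 0).
Proof. by split=> [|a x y fx fy]; rewrite ?linear0 // linearP /= fx fy scaler0 addr0. Qed.

Lemma submoduleI (R : pzRingType) (M : lmodType R) (P Q : M -> Prop) :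
  submodule P -> submodule Q -> submodule (fun x => P x /\ Q x).
Proof. by move=> [P0 PD] [Q0 QD]; split=> // a x y [? ?] [? ?]; split; auto. Qed.

Lemma submodule_imp (R : pzRingType) (M : lmodType R) (A : Prop) (P : M -> Prop) :
  submodule P -> submodule (fun x => A -> P x).
Proof. by move=> [P0 PD]; split=> // a x y ? ? ?; auto. Qed.

Lemma submodule_forall (R : pzRingType) (M : lmodType R) (I : Type)
    (P : I -> M -> Prop) :
  (forall i, submodule (P i)) -> submodule (fun x => forall i, P i x).
Proof.
by move=> hP; split=> [i|a x y Px Py i]; case: (hP i) => // _; apply.
Qed.

Definition inspan (R : pzRingType) (M : lmodType R) n (g : 'I_n -> M) (x : M) :=
  exists c : 'I_n -> R, x = \sum_(k < n) c k *: g k.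

Lemma submodule_span (R : pzRingType) (M : lmodType R) n (g : 'I_n -> M) :
  submodule (inspan g).
Proof.
split; first by exists (fun=> 0); rewrite big1 // => k _; rewrite scale0r.
move=> a _ _ [c ->] [e ->]; exists (fun k => a * c k + e k).
rewrite scaler_sumr -big_split; apply: eq_bigr => k _ /=.
by rewrite scalerDl scalerA.
Qed.

Lemma submodule_sum (R : pzRingType) (M : lmodType R) (P : M -> Prop) n
    (c : 'I_n -> R) (g : 'I_n -> M) :
  submodule P -> (forall k, P (g k)) -> P (\sum_(k < n) c k *: g k).
Proof.
by move=> [P0 PD] Pg; elim/big_rec: _ => // k x _ Px; apply: PD.
Qed.

(** Induction on the number of generators. The coefficients at [g ord0] of elements of [P] form a
    left ideal [I]. Finitely many elements of [P] realize its generators, and subtracting a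
    combination of them leaves an element of [P] in the span of the other generators. *)
Lemma noetherian_span (R : pzRingType) (M : lmodType R) n (g : 'I_n -> M)
    (P : M -> Prop) :
  left_noetherian R -> submodule P -> (forall x, P x -> inspan g x) ->
  exists m (h : 'I_m -> M), (forall k, P (h k)) /\ forall x, P x -> inspan h x.
Proof.
move=> noethR; elim: n g P => [|n IHn] g P subP Pg.
  exists 0%N, (fun=> 0); split=> [[]//|x /Pg [c ->]].
  by exists c; rewrite !big_ord0.
pose g' k := g (lift ord0 k).
pose I r := exists x y, [/\ P x, inspan g' y & x = r *: g ord0 + y].
have [P0 PD] := subP; have [S0 SD] := submodule_span g'.
have idI : left_ideal I.
  split; first by exists 0, 0; rewrite scale0r addr0.
  move=> a r r' [x [y [Px gy xE]]] [x' [y' [Px' gy' xE']]].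
  exists (a *: x + x'), (a *: y + y'); split; [exact: PD | exact: SD |].
  by rewrite xE xE' scalerDr scalerDl scalerA addrACA.
have [m [r [Ir spanr]]] := noethR I idI.
have /choice [x /(_ _)/cid hx] := Ir.
have {hx} /all_sig [y hy] := hx.
pose Q z := P z /\ inspan g' z.
have [z Qz|m' [h [Qh spanh]]] := IHn g' Q (submoduleI subP (submodule_span g')).
  by case: Qz.
exists (m + m')%N.
exists (fun k => match split k with inl a => x a | inr b => h b end).
split=> [k|z Pz]; first by case: split => k'; [case: (hy k') | case: (Qh k')].
have [c zE] := Pg z Pz; rewrite big_ord_recl in zE.
have [e cE] : exists e : 'I_m -> R, c ord0 = \sum_(k < m) e k * r k.
  apply: spanr; exists z, (\sum_(i < n) c (lift ord0 i) *: g' i).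
  by split=> //; exists (fun k => c (lift ord0 k)).
(* The [e k] express the leading coefficient [c ord0] of [z] by the generators of [I], so the
   multiples of [g ord0] cancel in this difference. *)
have [|e' zE'] := spanh (z - \sum_(k < m) e k *: x k).
  split; first by rewrite addrC -scaleN1r; apply: PD => //;
    apply: submodule_sum => // k; case: (hy k).
  have -> : z - \sum_(k < m) e k *: x k =
    -1 *: \sum_(k < m) e k *: y k + \sum_(i < n) c (lift ord0 i) *: g' i.
    rewrite zE cE scaler_suml addrAC scaleN1r; congr (_ + _).
    rewrite -!sumrN -big_split; apply: eq_bigr => k _ /=.
    by case: (hy k) => _ _ {1}->; rewrite scalerDr scalerA opprD addrA subrr add0r.
  apply: SD; last by exists (fun k => c (lift ord0 k)).
  by apply: submodule_sum => [|k]; [exact: submodule_span | case: (hy k)].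
exists (fun k => match split k with inl a => e a | inr b => e' b end).
rewrite big_split_ord /=.
under eq_bigr => k _ do rewrite -[lshift _ _]/(unsplit (inl k)) unsplitK.
under [X in _ = _ + X]eq_bigr => k _ do
  rewrite -[rshift _ _]/(unsplit (inr k)) unsplitK.
by rewrite -zE' addrC subrK.
Qed.

Definition lincomb (R : pzRingType) (M : lmodType R) n (g : 'I_n -> M)
    (x : 'rV[R]_n) : M := \sum_(k < n) x 0 k *: g k.

Lemma lincomb_linear (R : pzRingType) (M : lmodType R) n (g : 'I_n -> M) :
  linear (lincomb g).
Proof.
move=> a x y; rewrite /lincomb scaler_sumr -big_split; apply: eq_bigr => k _ /=.
by rewrite !mxE scalerDl scalerA.
Qed.
HB.instance Definition _ (R : pzRingType) (M : lmodType R) n (g : 'I_n -> M) :=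
  GRing.isLinear.Build R 'rV[R]_n M *:%R (lincomb g) (lincomb_linear g).

Lemma inspan_lincomb (R : pzRingType) (M : lmodType R) n (g : 'I_n -> M) x :
  inspan g x <-> exists y, lincomb g y = x.
Proof.
split=> [[c ->]|[y <-]]; last by exists (y 0).
by exists (\row_k c k); apply: eq_bigr => k _; rewrite mxE.
Qed.

Lemma fin_gen_rV (R : pzRingType) n : fin_gen ('rV[R]_n : lmodType R).
Proof.
exists n, (delta_mx 0) => x; exists (x 0).
by rewrite [LHS]row_sum_delta.
Qed.

Lemma projective_rV (R : pzRingType) n : projective ('rV[R]_n : lmodType R).
Proof.
move=> A B g f gsurj; have /choice [h hE] := fun k => gsurj (f (delta_mx 0 k)).
exists (lincomb h : {linear _ -> _}) => x.
rewrite linear_sum [in RHS](row_sum_delta x) linear_sum.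
by apply: eq_bigr => k _; rewrite !linearZ /= hE.
Qed.

Lemma fin_gen_surj (R : pzRingType) (M N : lmodType R) (f : {linear M -> N}) :
  surjective f -> fin_gen M -> fin_gen N.
Proof.
move=> fsurj [n [g gM]]; exists n, (f \o g) => y.
have [x <-] := fsurj y; have [c ->] := gM x; exists c.
by rewrite linear_sum; apply: eq_bigr => k _; rewrite linearZ.
Qed.

Lemma noetherian_cover (R : pzRingType) (M : lmodType R) (P : M -> Prop) :
  left_noetherian R -> fin_gen M -> submodule P ->
  exists n (f : {linear 'rV[R]_n -> M}), forall x, P x <-> exists y, f y = x.
Proof.
move=> noethR [n [g gM]] subP.
have [m [h [Ph hP]]] := noetherian_span (g := g) noethR subP (fun x _ => gM x).
exists m, (lincomb h : {linear _ -> _}) => x; split; first by move/hP/inspan_lincomb.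
by case=> y <-; apply: submodule_sum.
Qed.

Lemma fin_gen_sub (R : pzRingType) (M : lmodType R) (P : M -> Prop)
    (hP : submodule P) :
  left_noetherian R -> fin_gen M -> fin_gen (sub hP).
Proof.
move=> noethR fgM; have [n [f fP]] := noetherian_cover noethR fgM hP.
have [|g gE] := @sub_factor R M P hP _ f; first by move=> x; apply/fP; exists x.
apply: (@fin_gen_surj _ _ _ g) (fin_gen_rV R n) => y.
by have /fP [x xy] := inclP y; exists x; apply: incl_inj; rewrite gE.
Qed.

Lemma projective_retract (R : pzRingType) (P Q : lmodType R)
    (i : {linear Q -> P}) (p : {linear P -> Q}) :
  cancel i p -> projective P -> projective Q.
Proof.
move=> ip projP A B g f gsurj.
have [h hE] := projP A B g (f \o p : {linear _ -> _}) gsurj.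
by exists (h \o i : {linear _ -> _}) => x /=; rewrite hE /= ip.
Qed.

Lemma projective_section (R : pzRingType) (A P : lmodType R)
    (f : {linear A -> P}) :
  projective P -> surjective f -> exists g : {linear P -> A}, cancel g f.
Proof. by move=> projP; apply: (projP A P f idfun). Qed.

(** The graph of [E] is a module that maps onto [P], and a section of this map selects the values of
    [f]. Liftings along quasi-isomorphisms and between resolutions thereby reduce to solving linear
    equations pointwise. *)
Lemma projective_select (R : pzRingType) (P B : lmodType R) (E : P -> B -> Prop) :
  projective P -> submodule (fun p : P * B => E p.1 p.2) ->
  (forall x, exists y, E x y) -> exists f : {linear P -> B}, forall x, E x (f x).
Proof.
move=> projP hE total.
pose p1 : {linear (P * B)%type -> P} := fst.
pose p2 : {linear (P * B)%type -> B} := snd.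
have [|s sK] := projective_section (f := p1 \o incl hE : {linear _ -> _}) projP.
  by move=> x; have [y Exy] := total x; have [z zE] := incl_ex hE (x := (x, y)) Exy;
     exists z; rewrite /= zE.
exists (p2 \o incl hE \o s : {linear _ -> _}) => x.
by have := inclP (s x); rewrite -[(incl hE (s x)).1]/((p1 \o incl hE) (s x)) sK.
Qed.

Lemma projective_dual_basis (R : pzRingType) (P : lmodType R) :
  fin_gen P -> projective P ->
  exists n (c : 'I_n -> {linear P -> R^o}) (g : 'I_n -> P),
    forall x, x = \sum_(k < n) (c k x : R) *: g k.
Proof.
move=> [n [g gP]] projP.
have [|s sK] := projective_section (f := lincomb g : {linear _ -> _}) projP.
  by move=> x; apply/inspan_lincomb/gP.
have /choice [c cE] (k : 'I_n) : exists c : {linear P -> R^o}, forall x, c x = s x 0 k.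
  by apply: exists_linear => a x y; rewrite linearP !mxE.
exists n, c, g => x; rewrite -{1}(sK x) /= /lincomb.
by apply: eq_bigr => k _; rewrite cE.
Qed.

(** * Complexes and lifting along quasi-isomorphisms *)

(** Dependent choice downwards from [b]. The step sees a whole family and changes its value at [i]
    only, so consecutive degrees are linked without casts. *)
Lemma int_choice (T : int -> Type) (b : int) (t0 : forall i, T i)
    (Q : forall i, T i -> T (i + 1) -> Prop) :
  (forall i : int, b < i -> Q i (t0 i) (t0 (i + 1))) ->
  (forall (i : int) (t : forall i, T i), i <= b ->
     (forall j : int, i < j -> Q j (t j) (t (j + 1))) -> exists v, Q i v (t (i + 1))) ->
  exists t : forall i, T i,
    (forall i : int, b < i -> t i = t0 i) /\ forall i, Q i (t i) (t (i + 1)).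
Proof.
move=> Q0 Qstep.
pose G (k : nat) (t : forall i, T i) := forall j : int, b - k%:Z < j -> Q j (t j) (t (j + 1)).
have step (p : nat * (forall i, T i)) : exists t', G p.1 p.2 ->
    G p.1.+1 t' /\ forall j : int, b - p.1%:Z < j -> t' j = p.2 j.
  case: p => k t /=; case: (pselect (G k t)) => [Gt|nG]; last by exists t.
  have [||v Qv] := Qstep (b - k%:Z) t; [lia | by move=> j; apply: Gt |].
  have out j : b - k%:Z < j -> dfwith t v j = t j.
    by move=> ij; apply: dfwith_out; apply/eqP => ji; lia.
  exists (dfwith t v) => _; split=> // j jb.
  case: (eqVneq j (b - k%:Z)) => [->|ji]; first by rewrite dfwith_in out ?ltrDl.
  by rewrite !out; [apply: Gt | |]; lia.
have {step} [nx nxP] := choice step.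
pose st := nat_rect (fun=> forall i, T i) t0 (fun k t => nx (k, t)).
have stG k : G k (st k).
  elim: k => [|k IHk]; first by move=> j jb; apply: Q0; lia.
  by case: (nxP (k, st k) IHk).
have st_add k l j : b - k%:Z < j -> st (l + k)%N j = st k j.
  move=> jk; elim: l => // l <-; have [_] := nxP (_, _) (stG (l + k)%N).
  by apply => /=; lia.
have st_eq k l j : b - k%:Z < j -> b - l%:Z < j -> st k j = st l j.
  by move=> jk jl; rewrite -(st_add k l) // addnC st_add.
(* After [k] steps the values in degrees above [b - k] are final, so this stage is late enough for
   degree [i]. *)
pose t i := st (absz (b - i)%R).+1 i; exists t; split=> i.
  by move=> bi; rewrite /t (st_eq _ 0%N) //; lia.
rewrite /t (st_eq (absz (b - (i + 1))%R).+1 (absz (b - i)%R).+1) ?subrr; try lia.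
by apply: stG; lia.
Qed.

(** Neither bounded nor finitely generated, so that it covers resolutions and, through [bc], the
    objects of the derived category. *)
Record cpx (R : pzRingType) := Cpx {
  co :> int -> lmodType R;
  cd : forall i j : int, {linear co i -> co j};
  cd_shape : forall i j, j != i + 1 -> forall x, cd i j x = 0;
  cd_cd : forall i j k x, cd j k (cd i j x) = 0 }.
Arguments cd {R} c i j.

Definition bc (R : pzRingType) (X : bcomplex R) : cpx R :=
  Cpx (@dif_shape R X) (@dif_dif R X).

Record cmor (R : pzRingType) (A B : cpx R) := Cmor {
  cm :> forall i, {linear A i -> B i};
  cmE : forall i j x, cm j (cd A i j x) = cd B i j (cm i x) }.

Notation raw f := (fun i => cm f i : _ -> _).

Definition bm (R : pzRingType) (X Y : bcomplex R) (f : chain_map X Y) :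
  cmor (bc X) (bc Y) := @Cmor R (bc X) (bc Y) f (@cmap_dif R X Y f).

Definition mcomp (R : pzRingType) (A B C : cpx R) (g : cmor B C) (f : cmor A B) :
  cmor A C.
Proof.
exists (fun i => g i \o f i : {linear A i -> C i}) => i j x.
by rewrite /= !cmE.
Defined.

(** Stated for bare families of functions, so that composites and constant families need no
    packaging as [cmor]. *)
Definition hty (R : pzRingType) (A B : cpx R) (f g : forall i, A i -> B i) : Prop :=
  exists h : forall i j : int, {linear A i -> B j},
    forall i x, f i x - g i x =
      cd B (i - 1) i (h i (i - 1) x) + h (i + 1) i (cd A i (i + 1) x).

Definition null (R : pzRingType) (A B : cpx R) (f : forall i, A i -> B i) : Prop :=
  hty f (fun i _ => 0).

Definition ccyc (R : pzRingType) (A : cpx R) (i : int) (x : A i) : Prop :=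
  forall j, cd A i j x = 0.

Definition cbd (R : pzRingType) (A : cpx R) (i : int) (x : A i) : Prop :=
  exists j (y : A j), cd A j i y = x.

(** The two halves of a quasi-isomorphism are kept apart because an isomorphism of D^b, composed
    with its inverse, yields one half in each order. *)
Definition cinj (R : pzRingType) (A B : cpx R) (f : forall i, A i -> B i) : Prop :=
  forall i (x : A i), ccyc x -> cbd (f i x) -> cbd x.

Definition csur (R : pzRingType) (A B : cpx R) (f : forall i, A i -> B i) : Prop :=
  forall i (y : B i), ccyc y -> exists x : A i, ccyc x /\ cbd (y - f i x).

Definition cqis (R : pzRingType) (A B : cpx R) (f : forall i, A i -> B i) : Prop :=
  cinj f /\ csur f.

Lemma quasi_isoE (R : pzRingType) (X Y : bcomplex R) (f : chain_map X Y) :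
  quasi_iso f <-> cqis (raw (bm f)).
Proof.
split=> [q | [inj_f sur_f] i]; last by split; [apply: inj_f | apply: sur_f].
by split=> i; case: (q i).
Qed.

Section Complexes.
Variable R : pzRingType.
Implicit Types A B C : cpx R.

Lemma cbd_prev A i j (x : A i) : i = j + 1 -> cbd x -> exists y, cd A j i y = x.
Proof.
move=> ij [k [y <-]]; case: (eqVneq k j) => [<-|kj]; first by exists y.
by exists 0; rewrite linear0 cd_shape // ij (inj_eq (addIr 1)) eq_sym.
Qed.

Lemma ccyc_next A i j (x : A i) : j = i + 1 -> cd A i j x = 0 -> ccyc x.
Proof.
by move=> -> dx k; case: (eqVneq k (i + 1)) => [->//|ki]; rewrite cd_shape.
Qed.

Lemma cbd_cd A i j (x : A i) : cbd (cd A i j x).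
Proof. by exists i, x. Qed.

Lemma ccycB A i (x y : A i) : ccyc x -> ccyc y -> ccyc (x - y).
Proof. by move=> cx cy j; rewrite linearB /= cx cy subr0. Qed.

Lemma cbd0 A i : cbd (0 : A i).
Proof. by exists i, 0; rewrite linear0. Qed.

Lemma cbdD A i (x y : A i) : cbd x -> cbd y -> cbd (x + y).
Proof.
have e : i = (i - 1) + 1 by rewrite subrK.
move=> /(cbd_prev e)[x' <-] /(cbd_prev e)[y' <-].
by exists (i - 1), (x' + y'); rewrite linearD.
Qed.

Lemma cbdN A i (x : A i) : cbd x -> cbd (- x).
Proof. by move=> [j [y <-]]; exists j, (- y); rewrite linearN. Qed.

Lemma cbdB A i (x y : A i) : cbd x -> cbd y -> cbd (x - y).
Proof. by move=> bx by_; apply: cbdD => //; apply: cbdN. Qed.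

Lemma cmor_ccyc A B (f : cmor A B) i (x : A i) : ccyc x -> ccyc (f i x).
Proof. by move=> cx j; rewrite -cmE cx linear0. Qed.

Lemma cmor_cbd A B (f : cmor A B) i (x : A i) : cbd x -> cbd (f i x).
Proof. by move=> [j [y <-]]; exists j, (f j y); rewrite cmE. Qed.

Lemma hty_ext A B (f g : forall i, A i -> B i) : (forall i x, f i x = g i x) -> hty f g.
Proof.
by move=> fg; exists (fun i j => \0) => i x; rewrite fg subrr linear0 addr0.
Qed.

Lemma hty_sym A B (f g : forall i, A i -> B i) : hty f g -> hty g f.
Proof.
move=> [h hE]; exists (fun i j => \- h i j : {linear _ -> _}) => i x.
by rewrite -opprB hE /= linearN opprD.
Qed.

Lemma hty_trans A B (f g k : forall i, A i -> B i) : hty f g -> hty g k -> hty f k.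
Proof.
move=> [h hE] [h' hE']; exists (fun i j => h i j \+ h' i j : {linear _ -> _}) => i x.
rewrite -(subrKA (g i x)) hE hE' /= linearD /=.
by rewrite addrACA.
Qed.

Lemma hty_post A B C (u : cmor B C) (f g : forall i, A i -> B i) :
  hty f g -> hty (fun i x => u i (f i x)) (fun i x => u i (g i x)).
Proof.
move=> [h hE]; exists (fun i j => u j \o h i j : {linear _ -> _}) => i x.
by rewrite -linearB hE linearD /= cmE.
Qed.

Lemma hty_pre A B C (u : cmor A B) (f g : forall i, B i -> C i) :
  hty f g -> hty (fun i x => f i (u i x)) (fun i x => g i (u i x)).
Proof.
move=> [h hE]; exists (fun i j => h i j \o u i : {linear _ -> _}) => i x.
by rewrite hE /= cmE.
Qed.

Lemma null_hty A B (f g : forall i, A i -> B i) : hty f g -> null g -> null f.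
Proof. exact: hty_trans. Qed.

Lemma null_pre A B C (u : cmor A B) (f : forall i, B i -> C i) :
  null f -> null (fun i x => f i (u i x)).
Proof. exact: hty_pre. Qed.

Lemma hty_cbd A B (f g : forall i, A i -> B i) i x :
  hty f g -> ccyc x -> cbd (f i x - g i x).
Proof. by move=> [h ->] cx; rewrite cx linear0 addr0; apply: cbd_cd. Qed.

Lemma cinj_hty A B (f g : forall i, A i -> B i) : hty f g -> cinj f -> cinj g.
Proof.
move=> fg inj_f i x cx bx; apply: (inj_f) => //.
by rewrite -[f i x](subrK (g i x)); apply: cbdD => //; apply: hty_cbd.
Qed.

Lemma csur_hty A B (f g : forall i, A i -> B i) : hty f g -> csur f -> csur g.
Proof.
move=> fg sur_f i y cy; have [x [cx bx]] := sur_f i y cy; exists x; split=> //.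
by rewrite -(subrKA (f i x)); apply: cbdD => //; apply: hty_cbd.
Qed.

Lemma cqis_hty A B (f g : forall i, A i -> B i) : hty f g -> cqis f -> cqis g.
Proof. by move=> fg [? ?]; split; [apply: cinj_hty fg _ | apply: csur_hty fg _]. Qed.

Section TwoOfThree.
Variables (A B C : cpx R) (g : cmor B C) (f : cmor A B).
Let gf i x := g i (f i x).

Lemma cinj_comp : cinj (raw g) -> cinj (raw f) -> cinj gf.
Proof. by move=> ig jf i x cx bx; apply/jf/ig => //; apply: cmor_ccyc. Qed.

Lemma csur_comp : csur (raw g) -> csur (raw f) -> csur gf.
Proof.
move=> sg sf i z cz; have [y [cy bz]] := sg i z cz; have [x [cx bx]] := sf i y cy.
exists x; split=> //; rewrite -(subrKA (g i y)); apply: cbdD => //.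
by rewrite -linearB; apply: cmor_cbd.
Qed.

Lemma cinj_first : cinj gf -> cinj (raw f).
Proof. by move=> inj i x cx bx; apply: inj => //; apply: cmor_cbd. Qed.

Lemma csur_last : csur gf -> csur (raw g).
Proof.
move=> sur i z cz; have [x [cx bx]] := sur i z cz.
by exists (f i x); split=> //; apply: cmor_ccyc.
Qed.

Lemma cinj_last : cinj gf -> csur (raw f) -> cinj (raw g).
Proof.
move=> inj sf i y cy bgy; have [x [cx bx]] := sf i y cy.
rewrite -[y](subrK (f i x)); apply: cbdD => //; apply: cmor_cbd.
apply: inj => //; rewrite /gf -[f i x](subKr y) linearB.
by apply: cbdB => //; apply: cmor_cbd.
Qed.

Lemma csur_first : csur gf -> cinj (raw g) -> csur (raw f).
Proof.
move=> sur ig i y cy; have [x [cx bx]] := sur i (g i y) (cmor_ccyc g cy).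
exists x; split=> //; apply: ig; first by apply/ccycB/cmor_ccyc.
by rewrite linearB.
Qed.

Lemma cqis_comp : cqis (raw g) -> cqis (raw f) -> cqis gf.
Proof. by move=> [? ?] [? ?]; split; [apply: cinj_comp | apply: csur_comp]. Qed.

Lemma cqis_first : cqis gf -> cqis (raw g) -> cqis (raw f).
Proof. by move=> [? ?] [? ?]; split; [apply: cinj_first | apply: csur_first]. Qed.

Lemma cqis_last : cqis gf -> cqis (raw f) -> cqis (raw g).
Proof. by move=> [? ?] [? ?]; split; [apply: cinj_last | apply: csur_last]. Qed.

End TwoOfThree.

Definition cproj A := forall i, projective (A i).
Definition cfg A := forall i, fin_gen (A i).
Definition upbd A (b : int) := forall i : int, b < i -> forall x : A i, x = 0.

Lemma submodule_rel (A B : lmodType R) (E : A -> B -> Prop) :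
  E 0 0 ->
  (forall a x x' y y', E x y -> E x' y' -> E (a *: x + x') (a *: y + y')) ->
  submodule (fun p : A * B => E p.1 p.2).
Proof. by move=> E0 ED; split=> // a [x y] [x' y'] /=; apply: ED. Qed.

(** The lift and the homotopy are built together by descending recursion: the homotopy out of degree
    [i + 1] enters the equation that the lift in degree [i] must solve. *)
Lemma lift_qis (F Z X : cpx R) b (s : cmor Z X) (q : cmor F X) :
  cproj F -> upbd F b -> cqis (raw s) ->
  exists g : cmor F Z, hty (raw q) (fun i x => s i (g i x)).
Proof.
move=> projF bF [inj_s sur_s].
pose T i : Type := ({linear F i -> Z i} * (forall j, {linear F i -> X j}))%type.
pose Q i (t : T i) (t' : T (i + 1)) := forall x,
  cd Z i (i + 1) (t.1 x) = t'.1 (cd F i (i + 1) x) /\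
  q i x = s i (t.1 x) + cd X (i - 1) i (t.2 (i - 1) x) + t'.2 i (cd F i (i + 1) x).
have [||t [_ tQ]] := @int_choice T b (fun i => (\0 : {linear F i -> Z i},
    fun j => \0 : {linear F i -> X j})) Q.
- by move=> i bi x; rewrite (bF i bi x) !linear0 !addr0.
- move=> i t _ Qt.
  pose E x (p : Z i * X (i - 1)) :=
    cd Z i (i + 1) p.1 = (t (i + 1)).1 (cd F i (i + 1) x) /\
    q i x = s i p.1 + cd X (i - 1) i p.2 + (t (i + 1)).2 i (cd F i (i + 1) x).
  have [||f fE] := @projective_select R (F i) (Z i * X (i - 1))%type E (projF i).
  + apply: submodule_rel; first by rewrite /E !linear0 !addr0.
    move=> a x x' [z y] [z' y'] [] /= h1 h2 [] /= h1' h2'; split.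
      by rewrite !linearP /= h1 h1'.
    rewrite !linearP /= h2 h2' !scalerDr.
    by rewrite addrACA [X in X + _]addrACA.
  (* Injectivity of [s] on cohomology writes the cocycle [w] as the coboundary of some [z']. The
     defect [y] left by [z'] is then a cocycle of X, which surjectivity writes as [s z'' + d v]. *)
  + move=> x; pose w := (t (i + 1)).1 (cd F i (i + 1) x).
    have ii : i < i + 1 by lia.
    have Qdx := Qt _ ii (cd F i (i + 1) x).
    have cw : ccyc w.
      by apply: (@ccyc_next _ _ (i + 1 + 1)) => //; case: Qdx => -> _; rewrite cd_cd linear0.
    have sw : s (i + 1) w =
        cd X i (i + 1) (q i x - (t (i + 1)).2 i (cd F i (i + 1) x)).
      case: Qdx => _; rewrite cmE addrK cd_cd linear0 addr0 linearB /= => ->.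
      by rewrite addrK.
    have /(cbd_prev (erefl : i + 1 = i + 1)) [z' z'E] : cbd w.
      by apply: inj_s => //; rewrite sw; apply: cbd_cd.
    pose y := q i x - (t (i + 1)).2 i (cd F i (i + 1) x) - s i z'.
    have [|z'' [cz'']] := sur_s i y.
      apply: (@ccyc_next _ _ (i + 1)) => //.
      by rewrite /y linearB /= -sw -z'E cmE subrr.
    move=> /(@cbd_prev _ _ (i - 1)); rewrite subrK => /(_ erefl) [v vE].
    exists (z' + z'', v); split=> /=; first by rewrite linearD /= z'E cz'' addr0.
    rewrite vE linearD /= /y -[_ - _ - s i z'']addrA -opprD.
    by rewrite [s i z' + s i z'' + _]addrC !subrK.
  pose f1 : {linear F i -> Z i} := fst \o f.
  pose f2 : {linear F i -> X (i - 1)} := snd \o f.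
  exists (f1, dfwith (fun j => \0 : {linear F i -> X j}) f2) => x /=.
  by rewrite dfwith_in; have := fE x.
unshelve eexists.
  exists (fun i => (t i).1) => i j x.
  case: (eqVneq j (i + 1)) => [->|ij]; first by case: (tQ i x).
  by rewrite !cd_shape // linear0.
exists (fun i => (t i).2) => i x /=.
by case: (tQ i x) => _ ->; rewrite -[X in X - _]addrA [LHS]addrC addKr.
Qed.

(** The first component of the recursion contracts [f]; the second is a homotopy of homotopies
    comparing [s] after this contraction with the given [h]. That comparison shows in each degree
    that the remaining error [w] is a coboundary. *)
Lemma null_cancel_qis (F Z X : cpx R) b (s : cmor Z X) (f : cmor F Z) :
  cproj F -> upbd F b -> cqis (raw s) -> null (fun i x => s i (f i x)) -> null (raw f).
Proof.
move=> projF bF [inj_s sur_s] [h hE].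
pose T i : Type := ((forall j, {linear F i -> Z j}) * (forall j, {linear F i -> X j}))%type.
pose Q i (t : T i) (t' : T (i + 1)) := forall x,
  f i x = cd Z (i - 1) i (t.1 (i - 1) x) + t'.1 i (cd F i (i + 1) x) /\
  h i (i - 1) x + t'.2 (i - 1) (cd F i (i + 1) x) =
    s (i - 1) (t.1 (i - 1) x) + cd X (i - 1 - 1) (i - 1) (t.2 (i - 1 - 1) x).
have [||t [_ tQ]] := @int_choice T b (fun i => (fun j => \0 : {linear F i -> Z j},
    fun j => \0 : {linear F i -> X j})) Q.
- by move=> i bi x; rewrite (bF i bi x) !linear0 !addr0.
- move=> i t _ Qt.
  pose E x (p : Z (i - 1) * X (i - 1 - 1)) :=
    f i x = cd Z (i - 1) i p.1 + (t (i + 1)).1 i (cd F i (i + 1) x) /\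
    h i (i - 1) x + (t (i + 1)).2 (i - 1) (cd F i (i + 1) x) =
      s (i - 1) p.1 + cd X (i - 1 - 1) (i - 1) p.2.
  have [||k kE] := @projective_select R (F i) (Z (i - 1) * X (i - 1 - 1))%type E (projF i).
  + apply: submodule_rel; first by rewrite /E !linear0 !addr0.
    move=> a x x' [z y] [z' y'] [] /= h1 h2 [] /= h1' h2'; split.
      by rewrite !linearP /= h1 h1' !scalerDr addrACA.
    by rewrite !linearP /= addrACA -scalerDr h2 h2' scalerDr addrACA.
  + move=> x; set dx := cd F i (i + 1) x.
    have ii : i < i + 1 by lia.
    have [] := Qt _ ii dx; rewrite !addrK => fdx hdx.
    rewrite /dx cd_cd linear0 addr0 -/dx in fdx; rewrite /dx cd_cd linear0 addr0 -/dx in hdx.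
    pose w := f i x - (t (i + 1)).1 i dx.
    have cw : ccyc w.
      apply: (@ccyc_next _ _ (i + 1)) => //.
      by rewrite /w linearB /= -cmE fdx subrr.
    pose v := h i (i - 1) x + (t (i + 1)).2 (i - 1) dx.
    have sw : s i w = cd X (i - 1) i v.
      rewrite /w linearB /=; have := hE i x; rewrite subr0 => ->.
      by rewrite -/dx hdx linearD /= addrA addrAC addrK.
    have e : i = i - 1 + 1 by rewrite subrK.
    have /(cbd_prev e) [z' z'E] : cbd w.
      by apply: inj_s => //; rewrite sw; apply: cbd_cd.
    have [|z'' [cz'']] := sur_s (i - 1) (v - s (i - 1) z').
      apply: (@ccyc_next _ _ i) => //.
      by rewrite linearB /= -sw -z'E cmE subrr.
    move=> /(@cbd_prev _ _ (i - 1 - 1)); rewrite subrK => /(_ erefl) [y yE].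
    exists (z' + z'', y); split; first by rewrite /= linearD /= z'E cz'' addr0 subrK.
    rewrite /= -/v yE linearD /=.
    by rewrite -[v - _ - _]addrA -opprD [RHS]addrC subrK.
  pose k1 : {linear F i -> Z (i - 1)} := fst \o k.
  pose k2 : {linear F i -> X (i - 1 - 1)} := snd \o k.
  exists (dfwith (fun j => \0 : {linear F i -> Z j}) k1,
          dfwith (fun j => \0 : {linear F i -> X j}) k2) => x /=.
  by rewrite !dfwith_in; have := kE x.
by exists (fun i => (t i).1) => i x; case: (tQ i x) => -> _; rewrite subr0.
Qed.

(* Besides inducing isomorphisms on cohomology, a strong resolution lifts pairs
   of compatible elements on the nose, so that cones and shifts of strong
   resolutions are again strong. *)
Definition strong (F X : cpx R) (q : cmor F X) : Prop :=
  forall i j (z : F j) (x : X i), j = i + 1 -> ccyc z -> q j z = cd X i j x ->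
  exists w, cd F i j w = z /\ q i w = x.

Lemma strong_qis (F X : cpx R) (q : cmor F X) : strong q -> cqis (raw q).
Proof.
move=> sq; split=> i x cx.
  have e : i = i - 1 + 1 by rewrite subrK.
  move=> /(cbd_prev e) [y yE].
  by have [w [<- _]] := sq (i - 1) i x y e cx (esym yE); apply: cbd_cd.
have [||w [dw <-]] := sq i (i + 1) 0 x erefl; first by move=> k; rewrite linear0.
  by rewrite cx linear0.
by exists w; split; [apply: ccyc_next dw | rewrite subrr; apply: cbd0].
Qed.

(** The lift is strict, so a chain map and its lift to resolutions form a commutative square, as
    needed for a map of cones. *)
Lemma strong_lift (F F' X : cpx R) b (q : cmor F' X) (f : cmor F X) :
  cproj F -> upbd F b -> strong q ->
  exists g : cmor F F', forall i x, q i (g i x) = f i x.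
Proof.
move=> projF bF sq.
pose T i : Type := {linear F i -> F' i}.
pose Q i (t : T i) (t' : T (i + 1)) := forall x,
  cd F' i (i + 1) (t x) = t' (cd F i (i + 1) x) /\ q i (t x) = f i x.
have [||t [_ tQ]] := @int_choice T b (fun i => \0 : {linear F i -> F' i}) Q.
- by move=> i bi x; rewrite (bF i bi x) !linear0.
- move=> i t _ Qt.
  pose E x y := cd F' i (i + 1) y = t (i + 1) (cd F i (i + 1) x) /\ q i y = f i x.
  apply: (@projective_select R (F i) (F' i) E) => //.
    apply: (@submodule_rel _ _ E); first by rewrite /E !linear0.
    by move=> a x x' y y' [h1 h2] [h1' h2']; rewrite /E !linearP /= h1 h2 h1' h2'.
  move=> x; have ii : i < i + 1 by lia.
  have [h1 h2] := Qt _ ii (cd F i (i + 1) x).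
  apply: sq => //; last by rewrite h2 cmE.
  by apply: (@ccyc_next _ _ (i + 1 + 1)) => //; rewrite h1 cd_cd linear0.
suff tE i j x : t j (cd F i j x) = cd F' i j (t i x).
  by exists (Cmor tE) => i x /=; case: (tQ i x).
case: (eqVneq j (i + 1)) => [->|ij]; first by case: (tQ i x).
by rewrite !cd_shape // linear0.
Qed.

End Complexes.

(** * Resolutions and their truncations *)

Lemma low_bound (R : pzRingType) (X : bcomplex R) :
  exists n : nat, forall i : int, i < - n%:Z -> forall x : X i, x = 0.
Proof. by have [n nP] := ob_bounded X; exists n => i i_n; apply: nP; lia. Qed.

Lemma high_bound (R : pzRingType) (X : bcomplex R) : exists b, upbd (bc X) b.
Proof. by have [n nP] := ob_bounded X; exists n => i i_n; apply: nP; lia. Qed.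

(** One degree of a resolution under construction. The cocycles are recorded as a submodule before
    any differential is named, so that each step refers to the next higher degree only. *)
Record stage (R : pzRingType) (V : lmodType R) := Stage {
  stage_ob : lmodType R;
  stage_map : {linear stage_ob -> V};
  stage_cyc : stage_ob -> Prop;
  stage_sub : submodule stage_cyc;
  stage_fg : fin_gen stage_ob;
  stage_proj : projective stage_ob }.

(** In degree [i] take a free cover of the module [K] of pairs (z, x) of a cocycle z of F^(i+1) and
    an element x of X^i with q z = d x. The two projections give the differential and [q];
    surjectivity onto [K] is exactly strongness. *)
Lemma resolution (R : pzRingType) (noethR : left_noetherian R) (X : bcomplex R) b :
  upbd (bc X) b -> exists (F : cpx R) (q : cmor F (bc X)),
    [/\ cproj F, cfg F, upbd F b & strong q].
Proof.
move=> bX; pose T i := stage (X i).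
pose E i (t : T i) (t' : T (i + 1)) (d : {linear stage_ob t -> stage_ob t'}) :=
  [/\ forall x, stage_cyc x <-> d x = 0,
      forall x, dif X i (i + 1) (stage_map t x) = stage_map t' (d x),
      forall x, stage_cyc (d x) &
      forall z x, stage_cyc z -> stage_map t' z = dif X i (i + 1) x ->
        exists w, d w = z /\ stage_map t w = x].
pose Q i t t' := exists d, @E i t t' d.
have subT n : submodule (fun x : 'rV[R]_n => True) by [].
pose t0 i : T i := Stage (\0 : {linear 'rV[R]_0 -> X i}) (subT 0%N) (fin_gen_rV R 0)
  (@projective_rV R 0).
have [i bi||t [tb tQ]] := @int_choice T b t0 Q.
- exists \0; split=> [x|x|x|z x _ _] //=; first by rewrite linear0.
  by exists 0; split; [apply/rowP => -[] | rewrite (bX i bi x)].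
- move=> i t _ _; set t' := t (i + 1).
  pose K (p : stage_ob t' * X i) :=
    stage_cyc p.1 /\ stage_map t' p.1 = dif X i (i + 1) p.2.
  have subK : submodule K.
    apply: (@submodule_rel _ _ _ (fun z x =>
      stage_cyc z /\ stage_map t' z = dif X i (i + 1) x)).
      by rewrite !linear0; split=> //; case: (stage_sub t').
    move=> a z z' x x' [cz zx] [cz' zx']; split; last by rewrite !linearP /= zx zx'.
    by case: (stage_sub t') => _; apply.
  have [n [f fK]] := noetherian_cover noethR
    (fin_gen_prod (stage_fg t') (ob_fin_gen X i)) subK.
  pose f1 : {linear 'rV[R]_n -> stage_ob t'} := fst \o f.
  pose f2 : {linear 'rV[R]_n -> X i} := snd \o f.
  exists (Stage f2 (submodule_ker f1) (fin_gen_rV R n) (@projective_rV R n)).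
  exists f1; split=> //= [x|x|z x cz zx].
  + by have /fK [_ ->] : exists y, f y = f x by exists x.
  + by have /fK [] : exists y, f y = f x by exists x.
  + by have /fK [y yE] : K (z, x) by []; exists y; rewrite yE.
pose F i := stage_ob (t i).
have /all_sig [d dE] := fun i => cid (tQ i).
pose D i j : {linear F i -> F j} := @transport R F (i + 1) j \o d i.
have DE i x : D i (i + 1) x = d i x by rewrite /= transport_id.
have D0 i j : j != i + 1 -> forall x, D i j x = 0.
  by move=> ij x; rewrite /= transport0 // eq_sym.
have DD i j k x : D j k (D i j x) = 0.
  case: (eqVneq j (i + 1)) => [->|ij]; last by rewrite (D0 i j) // linear0.
  case: (eqVneq k (i + 1 + 1)) => [->|jk]; last by rewrite D0.
  by rewrite !DE; case: (dE (i + 1)) => h _ _ _; apply/h; case: (dE i).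
have qE i j x : stage_map (t j) (D i j x) = dif X i j (stage_map (t i) x).
  case: (eqVneq j (i + 1)) => [->|ij]; last by rewrite D0 // dif_shape // linear0.
  by rewrite DE; case: (dE i).
exists (Cpx D0 DD), (@Cmor R (Cpx D0 DD) (bc X) (fun i => stage_map (t i)) qE).
split=> [i|i|i bi|]; [exact: stage_proj | exact: stage_fg | |].
  by rewrite /= /F tb // => x; apply/rowP => -[].
move=> i j z x ij; move: z; rewrite {}ij => z cz /= zx; have [_ _ _] := dE i.
move=> /(_ z x) [||w [dw wx]] //; last by exists w; rewrite transport_id.
by case: (dE (i + 1)) => h _ _ _; apply/h; rewrite -DE; apply: cz.
Qed.

Section Truncation.
Variables (R : pzRingType) (noethR : left_noetherian R).
Variables (F : cpx R) (a b : int) (fgF : cfg F) (bF : upbd F b).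

(* The truncation (0 -> F^a/B^a -> F^(a+1) -> ...), with F^a/B^a realized as the
   submodule Z^(a+1) of F^(a+1) (isomorphic to it when F is exact in degrees a
   and a + 1); all the terms are submodules of F^i x F^(i+1). *)
Definition trunc_pred i (p : F i * F (i + 1)) : Prop :=
  (i <= a -> p.1 = 0) /\ (i != a -> p.2 = 0) /\ forall j, cd F (i + 1) j p.2 = 0.

Lemma trunc_submodule i : submodule (@trunc_pred i).
Proof.
pose p1 : {linear (F i * F (i + 1)%R)%type -> F i} := fst.
pose p2 : {linear (F i * F (i + 1)%R)%type -> F (i + 1)} := snd.
apply: submoduleI; first exact/submodule_imp/(submodule_ker p1).
apply: submoduleI; first exact/submodule_imp/(submodule_ker p2).
by apply: submodule_forall => j; apply: (submodule_ker (cd F (i + 1) j \o p2)).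
Qed.

Definition trunc_ob i : lmodType R := sub (trunc_submodule i).
Notation tv := (incl (trunc_submodule _)).

Lemma trunc_dif_ex i j : exists d : {linear trunc_ob i -> trunc_ob j},
  forall x, tv (d x) = (cd F i j (tv x).1 + transport F j (tv x).2, 0).
Proof.
pose f (p : F i * F (i + 1)) : F j * F (j + 1) :=
  (cd F i j p.1 + transport F j p.2, 0).
have [|g gE] := @exists_linear _ _ _ f.
  move=> c p p'; rewrite /f /= !linearP /=; congr (_, _).
    by rewrite /= scalerDr addrACA.
  by rewrite /= scaler0 addr0.
have [|h hE] := @sub_factor _ _ _ (trunc_submodule j) _ (g \o tv : {linear trunc_ob i -> _}).
  move=> x; rewrite /= gE; split=> [ja|]; last by split=> // k; rewrite linear0.
  have [x1 [x2 _]] := inclP x; rewrite /=.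
  case: (eqVneq j (i + 1)) => [ji|ij]; last by rewrite cd_shape // transport0 1?eq_sym ?addr0.
  by rewrite x1 ?x2 ?linear0 ?addr0 //; [apply/eqP|]; lia.
by exists h => x; rewrite hE /= gE.
Qed.

Definition trunc_dif i j := sval (cid (trunc_dif_ex i j)).

Lemma trunc_difE i j x :
  tv (trunc_dif i j x) = (cd F i j (tv x).1 + transport F j (tv x).2, 0).
Proof. exact: (svalP (cid (trunc_dif_ex i j))). Qed.

Lemma trunc_dif_shape i j : j != i + 1 -> forall x, trunc_dif i j x = 0.
Proof.
move=> ij x; apply: (incl_inj (hP := trunc_submodule j)); rewrite trunc_difE.
by rewrite cd_shape // transport0 1?eq_sym // addr0 linear0.
Qed.

Lemma trunc_dif_dif i j k x : trunc_dif j k (trunc_dif i j x) = 0.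
Proof.
apply: (incl_inj (hP := trunc_submodule k)).
rewrite !trunc_difE /= linear0 linearD /= cd_cd addr0 add0r linear0.
congr (_, _) => /=; case: (eqVneq (i + 1) j) => [<-|ij].
  by rewrite transport_id; have [_ [_]] := inclP x; apply.
by rewrite transport0 // linear0.
Qed.

Lemma trunc_vanish i (x : trunc_ob i) : (tv x).1 = 0 -> (tv x).2 = 0 -> x = 0.
Proof.
move=> x1 x2; apply: (incl_inj (hP := trunc_submodule i)).
by rewrite linear0 [tv x]surjective_pairing x1 x2.
Qed.

Lemma trunc_low i (x : trunc_ob i) : i < a -> x = 0.
Proof.
by move=> ia; have [x1 [x2 _]] := inclP x;
   apply: trunc_vanish; [apply: x1 | apply/x2/eqP]; lia.
Qed.

Lemma trunc_bounded : exists n : nat, forall i : int, (n < `|i|)%N ->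
  forall x : trunc_ob i, x = 0.
Proof.
exists (`|a| + `|b|)%N => i hi x; have [ia|ai] := ltP i a; first exact: trunc_low.
by apply: trunc_vanish; apply: (bF); lia.
Qed.

Lemma trunc_fin_gen i : fin_gen (trunc_ob i).
Proof. exact/fin_gen_sub/fin_gen_prod. Qed.

Definition trunc : bcomplex R :=
  BComplex trunc_dif_shape trunc_dif_dif trunc_fin_gen trunc_bounded.

(** The canonical projection of F onto its truncation, in the model with terms inside F^i x
    F^(i+1). *)
Lemma trunc_can_ex : exists c : cmor F (bc trunc), forall i x,
  tv (c i x) = (if i <= a then 0 else x, if i == a then cd F i (i + 1) x else 0).
Proof.
have cP i : exists c : {linear F i -> trunc i}, forall x,
  tv (c x) = (if i <= a then 0 else x, if i == a then cd F i (i + 1) x else 0).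
  pose f x : F i * F (i + 1) :=
    (if i <= a then 0 else x, if i == a then cd F i (i + 1) x else 0).
  have [|g gE] := @exists_linear _ _ _ f.
    move=> e x y; rewrite /f; case: ifP => _; case: ifP => _; congr (_, _);
    by rewrite /= ?linearP ?scaler0 ?addr0.
  have [|h hE] := @sub_factor _ _ _ (trunc_submodule i) _ g.
    move=> x; rewrite gE; split=> /= [->//|]; split=> [/negbTE->//|j].
    by case: ifP; rewrite ?cd_cd ?linear0.
  by exists h => x; rewrite hE gE.
have /all_sig [c cE] := fun i => cid (cP i).
suff cC i j x : c j (cd F i j x) = trunc_dif i j (c i x).
  by exists (@Cmor R F (bc trunc) c cC) => i x; apply: cE.
apply: (incl_inj (hP := trunc_submodule j)); rewrite trunc_difE !cE /=.
case: (eqVneq j (i + 1)) => [->|ij]; last first.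
  by rewrite !(cd_shape ij) transport0 1?eq_sym // linear0 !if_same addr0.
rewrite transport_id cd_cd if_same; congr (_, _) => /=.
have [ia|ai] := leP i a; last first.
  by rewrite ifF ?ifF ?addr0 //; [apply/eqP | apply/negbTE]; lia.
rewrite linear0 add0r; have [ia'|ia'] := eqVneq i a; last by rewrite ifT //; lia.
by rewrite ifF //; apply/negbTE; lia.
Qed.

Definition trunc_can := sval (cid trunc_can_ex).

Lemma trunc_canE i x :
  tv (trunc_can i x) = (if i <= a then 0 else x, if i == a then cd F i (i + 1) x else 0).
Proof. exact: (svalP (cid trunc_can_ex)). Qed.

Hypothesis exF : forall z : F (a + 1), ccyc z -> cbd z.

(** By exactness the second component of an element in degree [a] is some [d y], and
    [f (d y) = d (f y)] vanishes with Y^a. This lets maps to such a Y descend to the truncation. *)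
Lemma trunc_snd (Y : cpx R) (f : cmor F Y) i (x : trunc_ob i) :
  (forall i : int, i <= a -> forall y : Y i, y = 0) -> f (i + 1) (tv x).2 = 0.
Proof.
move=> Y0; have [_ [x2 dx2]] := inclP x.
have [ia|ia] := eqVneq i a; last by rewrite x2 // linear0.
move: x x2 dx2; rewrite ia => x _ dx2.
have /(cbd_prev erefl) [y <-] := exF dx2.
by rewrite cmE [f a y]Y0 // linear0.
Qed.

Lemma trunc_map (Y : bcomplex R) (f : cmor F (bc Y)) :
  (forall i : int, i <= a -> forall y : Y i, y = 0) ->
  exists g : chain_map trunc Y, forall i x, g i x = f i (tv x).1.
Proof.
move=> Y0; pose p1 i : {linear (F i * F (i + 1)%R)%type -> F i} := fst.
pose g i : {linear trunc i -> Y i} := f i \o p1 i \o tv.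
suff gC i j x : g j (dif trunc i j x) = dif Y i j (g i x) by exists (ChainMap gC).
rewrite /= trunc_difE /= linearD /= cmE.
case: (eqVneq j (i + 1)) => [->|ij]; last by rewrite transport0 1?eq_sym ?linear0 ?addr0.
by rewrite transport_id (@trunc_snd (bc Y)) ?addr0.
Qed.

Lemma trunc_hty (Y : bcomplex R) (f g : forall i, F i -> Y i) :
  (forall i : int, i <= a -> forall y : Y i, y = 0) ->
  @hty R F (bc Y) f g ->
  @hty R (bc trunc) (bc Y) (fun i x => f i (tv x).1) (fun i x => g i (tv x).1).
Proof.
move=> Y0 [h hE]; pose p1 i : {linear (F i * F (i + 1)%R)%type -> F i} := fst.
exists (fun i j => h i j \o p1 i \o tv : {linear trunc i -> Y j}) => i x.
rewrite hE /= trunc_difE transport_id; congr (_ + _); rewrite linearD.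
suff -> : h (i + 1) i (tv x).2 = 0 by rewrite addr0.
have [_ [x2 _]] := inclP x; have [ia|/x2->] := eqVneq i a; last by rewrite linear0.
by apply: Y0; rewrite ia.
Qed.

Lemma trunc_qis (X : bcomplex R) (q : cmor F (bc X)) :
  (forall i : int, i <= a -> forall y : X i, y = 0) -> cqis (raw q) ->
  @cqis R (bc trunc) (bc X) (fun i x => q i (tv x).1).
Proof.
move=> X0 [inj_q sur_q]; split=> i x cx; last first.
  have [ia|ai] := leP i a.
    exists 0; split=> [j|]; rewrite linear0 // (X0 i ia x).
    by rewrite linear0 subr0; apply: cbd0.
  have [z [cz bz]] := sur_q i x cx.
  have [|w wE] := @incl_ex _ _ _ (trunc_submodule i) (z, 0).
    by split=> /= [|]; [lia | split=> // j; rewrite linear0].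
  exists w; rewrite wE; split=> // j; apply: (incl_inj (hP := trunc_submodule j)).
  by rewrite /= trunc_difE wE /= cz !linear0 addr0.
move=> bx; have := congr1 (fun w => (tv w).1) (cx (i + 1)).
rewrite /= trunc_difE linear0 /= transport_id => dx.
have [x1 [x2 _]] := inclP x.
have [ia|ai] := leP i a.
  suff -> : x = 0 by apply: cbd0.
  by apply: trunc_vanish; [apply: x1 | move: dx; rewrite x1 // linear0 add0r].
have {}x2 : (tv x).2 = 0 by apply/x2/eqP; lia.
rewrite x2 addr0 in dx.
have /(cbd_prev (esym (subrK 1 i))) [w wE] := inj_q i _ (ccyc_next erefl dx) bx.
have [ai'|ia] := ltP a (i - 1).
  have [|y yE] := @incl_ex _ _ _ (trunc_submodule (i - 1)) (w, 0).
    by split=> /= [|]; [lia | split=> // j; rewrite linear0].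
  exists (i - 1), y; apply: (incl_inj (hP := trunc_submodule i)).
  by rewrite /= trunc_difE yE /= wE linear0 addr0 -x2 -surjective_pairing.
(* Here [i - 1 = a]: the bottom term consists of cocycles of F^(a+1), so the preimage of [x] is its
   own first component. *)
have [|y yE] := @incl_ex _ _ _ (trunc_submodule (i - 1)) (0, transport F (i - 1 + 1) (tv x).1).
  split=> //=; split=> [|j]; first by move/eqP; lia.
  by move: (i - 1 + 1) (subrK 1 i) => k ->; rewrite transport_id; apply: (ccyc_next erefl dx).
exists (i - 1), y; apply: (incl_inj (hP := trunc_submodule i)).
rewrite /= trunc_difE yE /= linear0 add0r [RHS]surjective_pairing x2; congr (_, _).
by move: (i - 1 + 1) (subrK 1 i) => k ->; rewrite !transport_id.
Qed.

End Truncation.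

(** * Morphisms of the derived category *)

Section HomDerived.
Variables (R : pzRingType) (noethR : left_noetherian R).
Variables (F : cpx R) (b : int) (projF : cproj F) (fgF : cfg F) (bF : upbd F b).
Variables (X : bcomplex R) (q : cmor F (bc X)) (qis_q : cqis (raw q)).

Lemma resolution_exact i (z : F i) : (forall x : X i, x = 0) -> ccyc z -> cbd z.
Proof.
by move=> X0 cz; case: qis_q => inj_q _; apply: inj_q => //; rewrite (X0 (q i z));
   apply: cbd0.
Qed.

(** The map [f] becomes a roof through a truncation of F. Triviality of this roof gives a
    quasi-isomorphism [s] to the truncation that makes the front leg null-homotopic, and the
    projection of F to the truncation lifts along [s] up to homotopy. *)
Lemma Hom_zero_null (Y : bcomplex R) :
  Hom_zero X Y -> forall f : cmor F (bc Y), null (raw f).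
Proof.
(* Low enough for X and Y to vanish in degrees up to [a], and for X to vanish also in degree
   [a + 1], where F must be exact. *)
move=> XY0 f; have [m X0] := low_bound X; have [n Y0] := low_bound Y.
pose a : int := - (m%:Z + n%:Z) - 2.
have exF (z : F (a + 1)) : ccyc z -> cbd z.
  by apply: resolution_exact => x; apply: X0; rewrite /a; lia.
have X0' i : i <= a -> forall x : X i, x = 0 by move=> ia; apply: X0; rewrite /a in ia; lia.
have Y0' i : i <= a -> forall x : Y i, x = 0 by move=> ia; apply: Y0; rewrite /a in ia; lia.
have [p pE] := trunc_map noethR fgF bF exF q X0'.
have [g gE] := trunc_map noethR fgF bF exF f Y0'.
have qis_p : cqis (raw (bm p)).
  by refine (cqis_hty _ (trunc_qis noethR fgF bF X0' qis_q)); apply: hty_ext => i x; rewrite /= pE.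
have /quasi_isoE qp := qis_p.
have [V [s [t [/quasi_isoE qis_ps _ gs0]]]] := XY0 (Roof g qp).
have qis_s : cqis (raw (bm s)) := cqis_first (g := bm p) (f := bm s) qis_ps qis_p.
have [k kE] := lift_qis (trunc_can noethR a fgF bF) projF bF qis_s.
have gs : @null R (bc V) (bc Y) (fun i x => g i (s i x)) := gs0.
refine (null_hty _ (null_pre k gs)).
apply: hty_trans (hty_post (bm g) kE); apply: hty_ext => i x.
by rewrite /= gE trunc_canE /=; case: ifP => // ia; rewrite linear0; apply: Y0'.
Qed.

(** Given a roof with legs [s] and [f], lift [q] along [s] to [k]; the hypothesis contracts [f]
    after [k]. Truncating [k] and the homotopies gives a common refinement of the roof and the zero
    roof. *)
Lemma null_Hom_zero (Y : bcomplex R) :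
  (forall f : cmor F (bc Y), null (raw f)) -> Hom_zero X Y.
Proof.
move=> XY0 [Z s f qis_s]; have [m X0] := low_bound X; have [n Y0] := low_bound Y.
have [l Z0] := low_bound Z; pose a : int := - (m%:Z + n%:Z + l%:Z) - 2.
have exF (z : F (a + 1)) : ccyc z -> cbd z.
  by apply: resolution_exact => x; apply: X0; rewrite /a; lia.
have X0' i : i <= a -> forall x : X i, x = 0 by move=> ia; apply: X0; rewrite /a in ia; lia.
have Y0' i : i <= a -> forall x : Y i, x = 0 by move=> ia; apply: Y0; rewrite /a in ia; lia.
have Z0' i : i <= a -> forall x : Z i, x = 0 by move=> ia; apply: Z0; rewrite /a in ia; lia.
have [|k kE] := @lift_qis _ _ _ _ b (bm s) q projF bF; first exact/quasi_isoE.
have [p pE] := trunc_map noethR fgF bF exF q X0'.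
have [g gE] := trunc_map noethR fgF bF exF k Z0'.
have qis_p : cqis (raw (bm p)).
  by refine (cqis_hty _ (trunc_qis noethR fgF bF X0' qis_q)); apply: hty_ext => i x; rewrite /= pE.
have sgp : @hty R (bc (trunc noethR a fgF bF)) (bc X) (fun i w => p i w)
    (fun i w => s i (g i w)).
  apply: hty_trans (hty_trans _ (trunc_hty noethR fgF bF X0' kE)) _;
    by apply: hty_ext => i x; rewrite /= ?pE ?gE.
exists (trunc noethR a fgF bF), g, p; split.
- exact/quasi_isoE/(cqis_hty sgp qis_p).
- exact: hty_sym sgp.
- have fk : null (raw (mcomp (bm f) k)) by [].
  have := trunc_hty noethR fgF bF Y0' fk.
  by apply: hty_trans; apply: hty_ext => i x; rewrite /= gE.
Qed.

(** The degree [j] is left free to avoid casts of indices; a factorization through a degree other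
    than [i + 1] is zero. *)
Definition Hom_exact (A : cpx R) (i : int) (N : lmodType R) : Prop :=
  forall f : {linear A i -> N}, (forall j (x : A j), f (cd A j i x) = 0) ->
  exists j (g : {linear A j -> N}), forall x, f x = g (cd A i j x).

Lemma Hom_exact_next (A : cpx R) (i j : int) (N : lmodType R) (f : {linear A i -> N}) :
  j = i + 1 -> Hom_exact A i N -> (forall k (x : A k), f (cd A k i x) = 0) ->
  exists g : {linear A j -> N}, forall x, f x = g (cd A i j x).
Proof.
move=> ji exA fd; have [k [g gE]] := exA f fd.
have [kj|kj] := eqVneq k j; first by rewrite -kj; exists g.
by exists (\0 : {linear A j -> N}) => x; rewrite gE cd_shape ?linear0 // -ji.
Qed.

(** The target has N in degree [i] and zero elsewhere. A chain map to it is a map on F^i that kills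
    coboundaries, and a null-homotopy is a factorization through F^(i+1). *)
Lemma Hom_zero_stalk (N : lmodType R) (fgN : fin_gen N) (i : int) :
  Hom_zero X (cshift (- i) (stalk fgN)) <-> Hom_exact F i N.
Proof.
pose S := stalk_ob N; pose T := cshift (- i) (stalk fgN).
have dT j k (x : T j) : dif T j k x = 0 by rewrite /T /= shift_difE /= scaler0.
have T0 j : j != i -> forall x : T j, x = 0.
  move=> ji; rewrite /T /= /stalk_ob ifF; last by apply/negbTE; lia.
  by move=> x; apply/rowP => -[].
split=> [XT f fd|exF].
  pose g j : {linear F j -> T j} := @transport R S 0 (j - i) \o f \o @transport R F j i.
  have gd j k x : g k (cd F j k x) = cd (bc T) j k (g j x).
    rewrite /= dT; have [ki|ki] := eqVneq k i; last exact: T0.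
    by rewrite ki transport_id fd linear0.
  have [h hE] := Hom_zero_null XT (@Cmor R F (bc T) g gd).
  exists (i + 1), (@transport R S (i - i) 0 \o h (i + 1) i : {linear _ -> S 0}) => x.
  have := hE i x; rewrite subr0 /= dT add0r transport_id => <-.
  (* Generalizing [i - i] to a variable allows the equation [i - i = 0] to be substituted in
     types. *)
  by move: (i - i) (subrr i) => z ->; rewrite !transport_id.
apply: null_Hom_zero => f.
pose g : {linear F i -> S 0} := @transport R S (i - i) 0 \o f i.
have [|h hE] := @Hom_exact_next F i (i + 1) (S 0) g erefl exF.
  by move=> k x; rewrite /g /= cmE /= dT linear0.
pose h' j k : {linear F j -> T k} :=
  @transport R S 0 (k - i) \o h \o @transport R F j (i + 1).
exists h' => j x; rewrite subr0 /= dT add0r.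
have [ji|ji] := eqVneq j i; last by rewrite [LHS]T0 ?[RHS]T0.
rewrite {}ji in x *; rewrite transport_id -hE /g /=.
by move: (f i x); rewrite /T /=; move: (i - i) (subrr i) => z -> y; rewrite !transport_id.
Qed.
End HomDerived.

(** * Ext and projective dimension *)

Lemma nat_choice (T : nat -> Type) (Inv : forall k, T k -> Prop)
    (Q : forall k, T k -> T k.+1 -> Prop) (t0 : T 0%N) :
  Inv 0%N t0 ->
  (forall k t, Inv k t -> exists t', Inv k.+1 t' /\ Q k t t') ->
  exists f : forall k, T k, f 0%N = t0 /\ forall k, Q k (f k) (f k.+1).
Proof.
move=> Inv0 step.
pose S k := {t : T k | Inv k t}.
pose nx k (s : S k) := cid (step k (sval s) (svalP s)).
pose g := nat_rect S (exist _ t0 Inv0)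
  (fun k s => exist _ (sval (nx k s)) (svalP (nx k s)).1 : S k.+1).
exists (fun k => sval (g k)); split=> // k.
exact: (svalP (nx k (g k))).2.
Qed.

Definition Ext_exact (R : pzRingType) (M : lmodType R) (P : proj_resolution M)
    (i : nat) (N : lmodType R) : Prop :=
  forall f : {linear res_ob P i -> N}, Hom_cocycle f -> Hom_coboundary f.

Section ProjResolutions.
Variable R : pzRingType.

Lemma res_dd (M : lmodType R) (P : proj_resolution M) k x :
  res_d P k (res_d P k.+1 x) = 0.
Proof. by apply/res_exact; exists x. Qed.

Lemma res_aug_d (M : lmodType R) (P : proj_resolution M) x :
  res_aug P (res_d P 0 x) = 0.
Proof. by apply/res_exact0; exists x. Qed.

Lemma comparison (M : lmodType R) (P Q : proj_resolution M) :
  exists f : forall k, {linear res_ob P k -> res_ob Q k},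
    (forall x, res_aug Q (f 0%N x) = res_aug P x) /\
    forall k x, res_d Q k (f k.+1 x) = f k (res_d P k x).
Proof.
have [f0 f0E] := @res_proj _ _ P 0%N _ _ _ (res_aug P) (res_aug_surj Q).
pose T k : Type := {linear res_ob P k -> res_ob Q k}.
pose Inv k (t : T k) := forall x, exists y, res_d Q k y = t (res_d P k x).
have [||f [f0' fE]] := @nat_choice T Inv
  (fun k t t' => forall x, res_d Q k (t' x) = t (res_d P k x)) f0.
- by move=> x; apply/res_exact0; rewrite f0E res_aug_d.
- move=> k t It; pose E x y := res_d Q k y = t (res_d P k x).
  have [||g gE] := projective_select (E := E) (@res_proj _ _ P k.+1) => //.
    apply: (submodule_rel (E := E)); first by rewrite /E !linear0.
    by move=> a x x' y y' h h'; rewrite /E !linearP /= h h'.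
  exists g; split=> // x; apply/res_exact; rewrite gE res_dd linear0.
  by [].
by exists f; split=> // x; rewrite f0' f0E.
Qed.

(** With [f] and [g] the comparison maps, [1 - g f] is null-homotopic. A cocycle [u] on P is the sum
    of [u g f], a coboundary because [u g] is one on Q, and of [u (1 - g f)], where only the term
    [u h d] of the homotopy survives. *)
Lemma Ext_exact_indep (M N : lmodType R) (P Q : proj_resolution M) k :
  Ext_exact Q k.+1 N -> Ext_exact P k.+1 N.
Proof.
move=> exQ u cu; have [f [f0 fE]] := comparison P Q.
have [g [g0 gE]] := comparison Q P.
pose c k x := x - g k (f k x).
have c0 x : res_aug P (c 0%N x) = 0 by rewrite linearB /= g0 f0 subrr.
have cE n x : res_d P n (c n.+1 x) = c n (res_d P n x).
  by rewrite linearB /= gE fE.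
have clin n a x y : c n (a *: x + y) = a *: c n x + c n y.
  by rewrite /c !linearP /= addrACA -scalerDr.
have sel n (A : res_ob P n -> res_ob P n) : (forall a x y, A (a *: x + y) = a *: A x + A y) ->
    (forall x, exists y, res_d P n y = A x) ->
    exists h : {linear res_ob P n -> res_ob P n.+1}, forall x, res_d P n (h x) = A x.
  move=> lA; apply: (@projective_select _ _ _ (fun x y => res_d P n y = A x)) => //.
    exact: res_proj.
  apply: (@submodule_rel _ _ _ (fun x y => res_d P n y = A x)).
    by have := lA (-1) 0 0; rewrite scaler0 addr0 linear0 scaleN1r addNr => ->.
  by move=> a x x' y y' h h'; rewrite linearP /= h h' lA.
have [||h0 h0E] := @sel 0%N (c 0%N); first exact: clin.
  by move=> x; apply/res_exact0; rewrite c0.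
pose T n : Type := {linear res_ob P n -> res_ob P n.+1}.
pose Inv n (t : T n) := forall x, exists y, res_d P n.+1 y = c n.+1 x - t (res_d P n x).
have [||h [_ hE]] := @nat_choice T Inv
  (fun n t t' => forall x, res_d P n.+1 (t' x) = c n.+1 x - t (res_d P n x)) h0.
- by move=> x; apply/res_exact; rewrite linearB /= cE h0E subrr.
- move=> n t It; have [a x y||t' t'E] := @sel n.+1 (fun x => c n.+1 x - t (res_d P n x)).
  + by rewrite clin !linearP /= addrACA -scalerDr.
  + exact: It.
  exists t'; split=> // x; apply/res_exact.
  by rewrite linearB /= cE t'E res_dd linear0 subr0 subrr.
have [|v vE] := exQ (u \o g k.+1 : {linear _ -> _}).
  by move=> x; rewrite /= -gE cu.
exists ((v \o f k) \+ (u \o h k) : {linear _ -> _}) => x /=.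
rewrite -fE -vE /=; have := congr1 u (hE k x).
rewrite cu linearB /= => /esym/eqP; rewrite subr_eq0 => /eqP <-.
by rewrite -linearD /c addrC subrK.
Qed.

Lemma Ext_zeroP (M N : lmodType R) (P : proj_resolution M) k :
  Ext_exact P k.+1 N -> Ext_zero k.+1 M N.
Proof. by move=> exP Q; apply: Ext_exact_indep exP. Qed.

Lemma fin_proj_dim_exact (M : lmodType R) (P : proj_resolution M) :
  fin_proj_dim M -> exists n : nat, forall k N, (n <= k)%N -> Ext_exact P k.+1 N.
Proof.
move=> [Q [n Q0]]; exists n => k N nk; apply: (Ext_exact_indep (Q := Q)) => f _.
by exists \0 => x; rewrite (Q0 k.+1 _ x) ?linear0.
Qed.

Lemma fin_proj_dim_projective (M : lmodType R) : projective M -> fin_proj_dim M.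
Proof.
move=> projM.
pose ob n : lmodType R := if n is 0%N then M else 'rV[R]_0.
have proj_ob n : projective (ob n) by case: n => // n; apply: projective_rV.
have exact0 x : (idfun : {linear M -> M}) x = 0 <->
    exists y, (\0 : {linear ob 1%N -> ob 0%N}) y = x.
  by split=> [/= -> | [y <-]] //; exists 0.
have exact n (x : ob n.+1) : (\0 : {linear ob n.+1 -> ob n}) x = 0 <->
    exists y, (\0 : {linear ob n.+2 -> ob n.+1}) y = x.
  by split=> // _; exists 0; apply/rowP => -[].
have idsurj : surjective (idfun : {linear M -> M}) by move=> x; exists x.
exists (ProjResolution proj_ob idsurj exact0 exact), 0%N => -[//|k] _ x.
by apply/rowP => -[].
Qed.

Lemma fin_proj_dim_ker (P M : lmodType R) (e : {linear P -> M}) :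
  projective P -> surjective e -> fin_proj_dim (sub (submodule_ker e)) ->
  fin_proj_dim M.
Proof.
move=> projP esurj [Q [n Q0]].
pose ob k : lmodType R := if k is k'.+1 then res_ob Q k' else P.
pose i := incl (submodule_ker e).
pose d k : {linear ob k.+1 -> ob k} :=
  match k return {linear ob k.+1 -> ob k} with
  | 0%N => i \o res_aug Q | k'.+1 => res_d Q k' end.
have proj_ob k : projective (ob k) by case: k => // k; apply: res_proj.
have exact0 x : e x = 0 <-> exists y, d 0%N y = x.
  split=> [/(incl_ex (submodule_ker e)) [y <-]|[y <-]].
    by have [z <-] := res_aug_surj Q y; exists z.
  exact: (inclP (res_aug Q y)).
have exact k x : d k x = 0 <-> exists y, d k.+1 y = x.
  case: k x => [|k] x; last exact: res_exact.
  rewrite -(@res_exact0 _ _ Q); split=> [h|/= ->]; last by rewrite linear0.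
  by apply: (@incl_inj _ _ _ (submodule_ker e)); rewrite linear0.
exists (ProjResolution proj_ob esurj exact0 exact), n.+1 => -[//|k] nk x.
exact: (Q0 k).
Qed.

(** Dimension shifting. For [k = 0] the map of P_1 onto the first syzygy is a cocycle with values in
    that syzygy; it factors through P_0 and makes the syzygy a retract of P_0. Finitely generated
    coefficients suffice because the syzygies are finitely generated. *)
Lemma exact_fin_proj_dim (noethR : left_noetherian R) k (M : lmodType R)
    (P : proj_resolution M) :
  (forall n, fin_gen (res_ob P n)) ->
  (forall N, fin_gen N -> Ext_exact P k.+1 N) -> fin_proj_dim M.
Proof.
elim: k M P => [|k IHk] M P fgP exP;
  have augd := @res_aug_d M P; pose K := submodule_ker (res_aug P);
  have [d dE] := sub_factor K augd;
  apply: (@fin_proj_dim_ker _ _ (res_aug P) (@res_proj _ _ P 0%N) (res_aug_surj P)).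
  have [|x|s sE] := exP (sub K) _ d; first exact: fin_gen_sub.
    by apply: (@incl_inj _ _ _ K); rewrite dE res_dd linear0.
  apply: fin_proj_dim_projective.
  apply: (@projective_retract _ _ _ (incl K) s) (@res_proj _ _ P 0%N) => y.
  have /res_exact0 [x xE] := inclP y.
  by rewrite -xE -sE; apply: (@incl_inj _ _ _ K); rewrite dE.
have dsurj : surjective d.
  move=> y; have /res_exact0 [x xE] := inclP y.
  by exists x; apply: (@incl_inj _ _ _ K); rewrite dE.
have exact0 x : d x = 0 <-> exists y, res_d P 1 y = x.
  rewrite -res_exact -dE; split=> [->|h]; first by rewrite linear0.
  by apply: (@incl_inj _ _ _ K); rewrite linear0.
pose Q := ProjResolution (fun n => @res_proj _ _ P n.+1) dsurj exact0
  (fun n => @res_exact _ _ P n.+1).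
by apply: (IHk _ Q) => [n|N fgN]; [apply: fgP | apply: (exP N fgN)].
Qed.

End ProjResolutions.

Section Tail.
Variables (R : pzRingType) (F : cpx R) (a : int) (N : lmodType R).
Variables (e : {linear F a -> N}) (projF : cproj F).
Hypotheses (e_surj : surjective e)
  (e_exact : forall x, e x = 0 <-> cbd x)
  (exF : forall i (x : F i), i < a -> ccyc x -> cbd x).

Let aug : {linear F (a - 0%N%:Z) -> N} := e \o @transport R F (a - 0%N%:Z) a.

Lemma tail_aug_surj : surjective aug.
Proof.
move=> y; have [x <-] := e_surj y; exists (transport F (a - 0%N%:Z) x).
by rewrite /aug /=; move: (a - 0%N%:Z) (subr0 a) => k ->; rewrite !transport_id.
Qed.

Lemma tail_exact0 x : aug x = 0 <->
  exists y, cd F (a - 1%N%:Z) (a - 0%N%:Z) y = x.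
Proof.
have e1 : a - 0%N%:Z = a - 1%N%:Z + 1 by lia.
rewrite /aug /=.
have -> : e (transport F a x) = 0 <-> cbd x.
  by move: (a - 0%N%:Z) (subr0 a) x {e1} => k -> x; rewrite transport_id.
by split=> [/(cbd_prev e1)//|[y <-]]; apply: cbd_cd.
Qed.

Lemma tail_exact n (x : F (a - n.+1%:Z)) : cd F (a - n.+1%:Z) (a - n%:Z) x = 0 <->
  exists y, cd F (a - n.+2%:Z) (a - n.+1%:Z) y = x.
Proof.
split=> [dx|[y <-]]; last by rewrite cd_cd.
apply: cbd_prev; first lia.
by apply: exF; [lia | apply: ccyc_next dx; lia].
Qed.

(** The terms of F in degrees up to [a], renumbered downwards, resolve the cokernel N of F^(a-1) ->
    F^a. *)
Definition tail : proj_resolution N :=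
  ProjResolution (fun n => @projF (a - n%:Z)) tail_aug_surj tail_exact0 tail_exact.

Lemma tail_Ext_exact k (L : lmodType R) :
  Ext_exact tail k.+1 L <-> Hom_exact F (a - k.+1%:Z) L.
Proof.
split=> ex f cf; last first.
  apply: (@Hom_exact_next R F (a - k.+1%:Z) (a - k%:Z) L f) => //; first lia.
  move=> j x; have [jE|jE] := eqVneq j (a - k.+2%:Z).
    by move: x; rewrite jE => x; apply: cf.
  by rewrite cd_shape ?linear0 //; lia.
have [x|g gE] := ex f; first exact: cf.
by exists (a - k%:Z), g.
Qed.
End Tail.

(** * Shifts, sums and cones of resolutions *)

Section PairMaps.
Variables (R : pzRingType) (A B C D : lmodType R).
Variables (f : {linear A -> C}) (g : {linear B -> D}).

Definition pair_map (p : A * B) : C * D := (f p.1, g p.2).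

Lemma pair_map_linear : linear pair_map.
Proof. by move=> a p q; rewrite /pair_map /= !linearP. Qed.
HB.instance Definition _ :=
  GRing.isLinear.Build R (A * B)%type (C * D)%type *:%R pair_map pair_map_linear.

Definition inl_map (x : A) : A * B := (x, 0).
Lemma inl_map_linear : linear inl_map.
Proof. by move=> a x y; rewrite /inl_map; congr (_, _); rewrite /= scaler0 addr0. Qed.
HB.instance Definition _ :=
  GRing.isLinear.Build R A (A * B)%type *:%R inl_map inl_map_linear.

Definition inr_map (y : B) : A * B := (0, y).
Lemma inr_map_linear : linear inr_map.
Proof. by move=> a x y; rewrite /inr_map; congr (_, _); rewrite /= scaler0 addr0. Qed.
HB.instance Definition _ :=
  GRing.isLinear.Build R B (A * B)%type *:%R inr_map inr_map_linear.
End PairMaps.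

Lemma projective_prod (R : pzRingType) (P Q : lmodType R) :
  projective P -> projective Q -> projective (P * Q)%type.
Proof.
move=> projP projQ A B g f gsurj.
have [h hE] := projP A B g (f \o @inl_map R P Q : {linear _ -> _}) gsurj.
have [k kE] := projQ A B g (f \o @inr_map R P Q : {linear _ -> _}) gsurj.
pose p1 : {linear (P * Q)%type -> P} := fst.
pose p2 : {linear (P * Q)%type -> Q} := snd.
exists ((h \o p1) \+ (k \o p2) : {linear _ -> _}) => x /=.
rewrite linearD hE kE /= -linearD; congr (f _).
by rewrite [RHS]surjective_pairing; congr (_, _); rewrite /= ?addr0 ?add0r.
Qed.

Section ShiftSumCone.
Variable R : pzRingType.
Implicit Types F G : cpx R.

Definition pshift_dif (n : int) F i j : {linear F (i + n) -> F (j + n)} :=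
  if odd `|n|%N then (\- cd F (i + n) (j + n) : {linear F (i + n) -> F (j + n)})
  else (cd F (i + n) (j + n) : {linear F (i + n) -> F (j + n)}).

Lemma pshift_difE n F i j x :
  pshift_dif n F i j x = (-1) ^+ `|n|%N *: cd F (i + n) (j + n) x.
Proof. by rewrite -signr_odd /pshift_dif; case: odd; rewrite ?scaleN1r ?scale1r. Qed.

Lemma pshift_shape n F i j : j != i + 1 -> forall x, pshift_dif n F i j x = 0.
Proof. by move=> ij x; rewrite pshift_difE cd_shape ?scaler0 //; lia. Qed.

Lemma pshift_dd n F i j k x : pshift_dif n F j k (pshift_dif n F i j x) = 0.
Proof. by rewrite !pshift_difE linearZ /= cd_cd !scaler0. Qed.

Definition pshift n F : cpx R :=
  @Cpx R (fun i => F (i + n)) _ (@pshift_shape n F) (@pshift_dd n F).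

Lemma pshift_strong n F (X : bcomplex R) (q : cmor F (bc X)) :
  strong q -> exists p : cmor (pshift n F) (bc (cshift n X)), strong p.
Proof.
move=> sq.
have pE i j (x : F (i + n)) : q (j + n) (cd (pshift n F) i j x) =
    cd (bc (cshift n X)) i j (q (i + n) x).
  by rewrite /= pshift_difE shift_difE linearZ /= cmE.
exists (@Cmor R (pshift n F) (bc (cshift n X)) (fun i => q (i + n)) pE).
move=> i j z x ji cz /=; rewrite shift_difE => zx; pose s : R := (-1) ^+ `|n|%N.
have [|k||w [wz wx]] := sq (i + n) (j + n) (s *: z) x; first by rewrite ji addrAC.
- rewrite linearZ /= -[k](subrK n); have := cz (k - n).
  by rewrite /= pshift_difE => ->; rewrite /=.
- by rewrite linearZ /= zx scalerA -expr2 sqrr_sign scale1r.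
by exists w; split=> //=; rewrite pshift_difE wz scalerA -expr2 sqrr_sign scale1r.
Qed.

Lemma pshift_Hom_exact n F i (N : lmodType R) :
  Hom_exact F (i + n) N -> Hom_exact (pshift n F) i N.
Proof.
move=> exF f fd; pose s : R := (-1) ^+ `|n|%N.
have [||g gE] := @Hom_exact_next R F (i + n) (i + 1 + n) N f _ exF; first by rewrite addrAC.
  move=> k; rewrite -[k](subrK n) => x; have := fd (k - n) (s *: x).
  by rewrite /= pshift_difE !linearZ /= scalerA -expr2 sqrr_sign scale1r.
(* Multiplication by [s] is linear over a noncommutative ring because [s] is a sign; hence the case
   distinction. *)
have [h hE] : exists h : {linear F (i + 1 + n) -> N}, forall x, h x = g (s *: x).
  exists (if odd `|n|%N then (\- g : {linear _ -> _}) else g) => x.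
  by rewrite /s -signr_odd; case: odd; rewrite /= ?expr1 ?scaleN1r ?linearN ?scale1r.
exists (i + 1), h => x.
by rewrite hE /= pshift_difE scalerA -expr2 sqrr_sign scale1r.
Qed.

Definition psum_dif F G i j : {linear (F i * G i)%type -> (F j * G j)%type} :=
  pair_map (cd F i j) (cd G i j).

Lemma psum_shape F G i j : j != i + 1 -> forall p, psum_dif F G i j p = 0.
Proof. by move=> ij p; rewrite /= /pair_map !cd_shape. Qed.

Lemma psum_dd F G i j k p : psum_dif F G j k (psum_dif F G i j p) = 0.
Proof. by rewrite /= /pair_map /= !cd_cd. Qed.

Definition psum F G : cpx R := Cpx (@psum_shape F G) (@psum_dd F G).

Lemma psum_strong F G (X Y : bcomplex R) (p : cmor F (bc X)) (q : cmor G (bc Y)) :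
  strong p -> strong q ->
  exists r : cmor (psum F G) (bc (direct_sum X Y)), strong r.
Proof.
move=> sp sq.
have rE i j (x : psum F G i) : pair_map (p j) (q j) (cd (psum F G) i j x) =
    cd (bc (direct_sum X Y)) i j (pair_map (p i) (q i) x).
  by rewrite /= /pair_map /sum_dif /= !cmE.
exists (@Cmor R (psum F G) (bc (direct_sum X Y)) (fun i => pair_map (p i) (q i)) rE).
move=> i j [z1 z2] [x1 x2] ji cz [zx1 zx2].
have [k|w1 [wz1 wx1]] := sp i j z1 x1 ji _ zx1; first by case: (cz k).
have [k|w2 [wz2 wx2]] := sq i j z2 x2 ji _ zx2; first by case: (cz k).
exists (w1, w2); rewrite /= /pair_map /=.
by rewrite wz1 wz2 wx1 wx2.
Qed.

Lemma psum_Hom_exact F G i (N : lmodType R) :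
  Hom_exact (psum F G) i N -> Hom_exact F i N.
Proof.
move=> exS f fd; pose p1 : {linear (F i * G i)%type -> F i} := fst.
have [j x|j [g gE]] := exS (f \o p1 : {linear psum F G i -> N}); first exact: fd.
exists j, (g \o @inl_map R (F j) (G j) : {linear _ -> _}) => x.
by have := gE (x, 0); rewrite /= /pair_map /= linear0.
Qed.

Variables (F G : cpx R) (g : cmor F G).

Definition pcone_dif i j (p : F (i + 1) * G i) : F (j + 1) * G j :=
  (- cd F (i + 1) (j + 1) p.1, transport G j (g (i + 1) p.1) + cd G i j p.2).

Lemma pcone_dif_linear i j : linear (@pcone_dif i j).
Proof.
move=> a p q; rewrite /pcone_dif /= !linearP /=.
by congr (_, _); rewrite /= scalerDr addrACA.
Qed.
HB.instance Definition _ i j :=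
  GRing.isLinear.Build R (F (i + 1)%R * G i)%type (F (j + 1)%R * G j)%type *:%R
    (@pcone_dif i j) (@pcone_dif_linear i j).

Lemma pcone_shape i j : j != i + 1 -> forall p, @pcone_dif i j p = 0.
Proof.
move=> ij p; rewrite /pcone_dif !cd_shape ?(inj_eq (addIr 1)) //.
by rewrite transport0 1?eq_sym // oppr0 addr0.
Qed.

Lemma pcone_dd i j k p : @pcone_dif j k (@pcone_dif i j p) = 0.
Proof.
case: (eqVneq j (i + 1)) => [->|ij]; last by rewrite (pcone_shape ij) linear0.
case: (eqVneq k (i + 1 + 1)) => [->|jk]; last by rewrite pcone_shape.
rewrite /pcone_dif /= !transport_id !linearN /= cd_cd !oppr0.
by rewrite linearD /= cd_cd addr0 cmE addNr.
Qed.

Definition pcone : cpx R :=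
  @Cpx R (fun i => (F (i + 1)%R * G i)%type) (fun i j => @pcone_dif i j)
    pcone_shape pcone_dd.

Lemma pcone_strong (X Y : bcomplex R) (f : chain_map X Y)
    (p : cmor F (bc X)) (q : cmor G (bc Y)) :
  (forall i x, q i (g i x) = f i (p i x)) -> strong p -> strong q ->
  exists r : cmor pcone (bc (cone f)), strong r.
Proof.
move=> gf sp sq.
pose r i : {linear pcone i -> bc (cone f) i} := pair_map (p (i + 1)) (q i).
have rE i j (x : pcone i) : r j (cd pcone i j x) = cd (bc (cone f)) i j (r i x).
  rewrite /= /pair_map /pcone_dif /cone_dif /= linearN linearD /= !cmE.
  congr (_, _ + _); case: x => x y /=; move: (i + 1) x => k x {y}.
  have [<-|kj] := eqVneq k j; first by rewrite !transport_id gf.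
  by rewrite !transport0 ?linear0.
exists (@Cmor R pcone (bc (cone f)) r rE).
move=> i j z [x1 x2] ji; move: z; rewrite {}ji => -[z1 z2] cz.
have := cz (i + 1 + 1); rewrite /= /pcone_dif /= transport_id.
move=> [/eqP]; rewrite oppr_eq0 => /eqP dz1 dz2.
rewrite /cone_dif /pair_map /= transport_id => -[zx1 zx2].
(* The equations are triangular: solve for [w1], with the sign of the cone differential, and then
   for [w2] with [g w1] subtracted. *)
have [||w1 [dw1 pw1]] := sp (i + 1) (i + 1 + 1) (- z1) x1 erefl.
- by move=> k; rewrite linearN (ccyc_next erefl dz1) oppr0.
- by rewrite linearN zx1 opprK.
have [||w2 [dw2 qw2]] := sq i (i + 1) (z2 - g (i + 1) w1) x2 erefl.
- apply: (ccyc_next erefl); rewrite linearB /= -cmE dw1 linearN opprK [LHS]addrC.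
  exact: dz2.
- by rewrite linearB /= gf pw1 zx2 [LHS]addrC addKr.
exists (w1, w2); rewrite /= /pcone_dif /= transport_id dw1 dw2 opprK.
by rewrite [g _ _ + _]addrC subrK pw1 qw2.
Qed.

Lemma pcone_prev i (x : F i) (y : G (i - 1)) :
  cd pcone (i - 1) i (transport F (i - 1 + 1) x, y) =
  (- cd F i (i + 1) x, g i x + cd G (i - 1) i y).
Proof.
rewrite /= /pcone_dif /=; move: (i - 1 + 1) (subrK 1 i) => k ->.
by rewrite !transport_id.
Qed.

Lemma pcone_cyc i (N : lmodType R) (f : {linear pcone i -> N}) :
  (forall (x : F i) (y : G (i - 1)),
     f (- cd F i (i + 1) x, g i x + cd G (i - 1) i y) = 0) ->
  forall j (p : pcone j), f (cd pcone j i p) = 0.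
Proof.
move=> fd j; have [->|ij] := eqVneq j (i - 1); last first.
  by move=> p; rewrite cd_shape ?linear0 //; lia.
move=> [x y]; have := fd (transport F i x) y; rewrite -pcone_prev.
suff -> : transport F (i - 1 + 1) (transport F i x) = x by [].
by move: (i - 1 + 1) (subrK 1 i) x => k -> x; rewrite !transport_id.
Qed.

(** This and the next two lemmas are pieces of the long exact sequence of Hom(-, N) for the
    degreewise split sequence G -> cone -> Sigma F. Here [f] on G factors as [c] after the
    differential, and [f - c g] is a cocycle on F. *)
Lemma pcone_Hom_exact i (N : lmodType R) :
  Hom_exact F (i + 1) N -> Hom_exact G i N -> Hom_exact pcone i N.
Proof.
move=> exF exG f fd.
pose inl : {linear F (i + 1) -> pcone i} := @inl_map R _ _.
pose inr : {linear G i -> pcone i} := @inr_map R _ _.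
have fE p : f p = f (inl p.1) + f (inr p.2).
  rewrite -linearD; congr (f _); rewrite [LHS]surjective_pairing.
  by congr (_, _); rewrite /= ?addr0 ?add0r.
have [|c cE] := @Hom_exact_next R G i (i + 1) N (f \o inr : {linear _ -> _}) erefl exG.
- by move=> j y; have := fd j (inr_map _ y); rewrite /= /pcone_dif /=;
    rewrite !linear0 ?oppr0 add0r.
have [|d dE] := @Hom_exact_next R F (i + 1) (i + 1 + 1) N
  ((f \o inl) \- (c \o g (i + 1)) : {linear _ -> _}) erefl exF.
- move=> j x; have [ji|ji] := eqVneq j i; last by rewrite cd_shape ?linear0 //; lia.
  rewrite {}ji in x *; have := fd (i - 1) (transport F (i - 1 + 1) x, 0).
  rewrite pcone_prev linear0 addr0 fE /= linearN /= => h.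
  have := cE (g i x); rewrite /= -cmE => cg.
  apply/eqP; rewrite -oppr_eq0 opprB addrC -cg -[X in _ == X]h.
  by rewrite linearN.
have [e eE] : exists e : {linear pcone (i + 1) -> N}, forall p, e p = c p.2 - d p.1.
  apply: exists_linear => a [x y] [x' y'] /=.
  by rewrite !linearP /= addrACA -scalerDr.
exists (i + 1), e => -[x y]; rewrite eE /= transport_id linearD /=.
have := dE x; rewrite /= => /esym; rewrite linearN opprK => ->.
by rewrite fE /= -cE addrAC addrCA subrr addr0 addrC.
Qed.

(** As [f g] factors as [c d], the pair [(c, f)] is a cocycle on the cone; its factorization
    restricted to G is the wanted one. *)
Lemma pcone_Hom_exact_target i (N : lmodType R) :
  Hom_exact F i N -> Hom_exact pcone i N -> Hom_exact G i N.
Proof.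
move=> exF exC f fd.
have [|c cE] := @Hom_exact_next R F i (i + 1) N (f \o g i : {linear _ -> _}) erefl exF.
- by move=> j x; rewrite /= cmE fd.
have [e eE] : exists e : {linear pcone i -> N}, forall p, e p = c p.1 + f p.2.
  apply: exists_linear => a [x y] [x' y'] /=.
  by rewrite !linearP /= addrACA -scalerDr.
have [|d dE] := @Hom_exact_next R pcone i (i + 1) N e erefl exC.
- apply: pcone_cyc => x y; rewrite eE /= linearN linearD /= fd addr0.
  by have := cE x => /= ->; rewrite addNr.
exists (i + 1), (d \o @inr_map R _ _ : {linear G (i + 1) -> N}) => y.
have := dE (0, y); rewrite eE /= linear0 add0r => ->.
by rewrite /pcone_dif /= !linear0 ?oppr0 add0r.
Qed.

(** A factorization [d] of [f] through the cone need not vanish on G. Its restriction to G is a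
    cocycle, hence factors through some [c], and [c g - d] on F corrects it. *)
Lemma pcone_Hom_exact_source i (N : lmodType R) :
  Hom_exact pcone i N -> Hom_exact G (i + 1) N -> Hom_exact F (i + 1) N.
Proof.
move=> exC exG f fd.
have [e eE] : exists e : {linear pcone i -> N}, forall p, e p = f p.1.
  by apply: exists_linear => a [x y] [x' y'] /=; rewrite !linearP.
have [|d dE] := @Hom_exact_next R pcone i (i + 1) N e erefl exC.
- by apply: pcone_cyc => x y; rewrite eE /= linearN fd oppr0.
pose inl : {linear F (i + 1 + 1) -> pcone (i + 1)} := @inl_map R _ _.
pose inr : {linear G (i + 1) -> pcone (i + 1)} := @inr_map R _ _.
have [|c cE] := @Hom_exact_next R G (i + 1) (i + 1 + 1) N
  (d \o inr : {linear _ -> _}) erefl exG.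
- move=> j y; have [ji|ji] := eqVneq j i; last by rewrite cd_shape ?linear0 //; lia.
  rewrite {}ji in y *; have := dE (0, y); rewrite eE /= linear0 /pcone_dif /=.
  by rewrite !linear0 ?oppr0 add0r => <-.
exists (i + 1 + 1), ((c \o g (i + 1 + 1)) \- (d \o inl) : {linear _ -> _}) => x.
have := dE (x, 0); rewrite eE /= => ->; rewrite /pcone_dif /= transport_id linear0 addr0.
have -> : d (- cd F (i + 1) (i + 1 + 1) x, g (i + 1) x) =
    d (inr (g (i + 1) x)) - d (inl (cd F (i + 1) (i + 1 + 1) x)).
  rewrite -linearB; congr (d _); rewrite [RHS]surjective_pairing.
  by congr (_, _); rewrite /= ?sub0r ?subr0.
by have := cE (g (i + 1) x) => /= ->; rewrite cmE.
Qed.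
End ShiftSumCone.

(** * Complexes with bounded Ext *)

(** All backward legs are quasi-isomorphisms, so the comparison of roofs makes [front v] after [g]
    one too. Hence [front v] is surjective and [g] injective on cohomology, and the homotopy square
    passes injectivity on to [front u]. *)
Lemma is_comp_qis (R : pzRingType) (X Y Z : bcomplex R) (u : roof X Y) (v : roof Y Z)
    (w : roof X Z) :
  is_comp u v w -> cqis (raw (bm (front w))) ->
  cinj (raw (bm (front u))) /\ csur (raw (bm (front v))).
Proof.
move=> [W [s [g [qw [fsg [W' [s' [t' [/quasi_isoE qs' bb ff]]]]]]]]] qis_w.
have /quasi_isoE qbu := @back_qis _ _ _ u; have /quasi_isoE qbv := @back_qis _ _ _ v.
have /quasi_isoE qbw := @back_qis _ _ _ w; have /quasi_isoE qbus := qw.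
have qis_s : cqis (raw (bm s)) := cqis_first (g := bm (back u)) (f := bm s) qbus qbu.
have qis_s' : cqis (raw (bm s')) := cqis_first (g := bm (back w)) (f := bm s') qs' qbw.
have bbE : hty (fun i x => bm (back w) i (bm s' i x))
  (fun i x => bm (comp_map (back u) s) i (bm t' i x)) := bb.
have ffE : hty (fun i x => bm (front w) i (bm s' i x))
  (fun i x => bm (comp_map (front v) g) i (bm t' i x)) := ff.
have sgE : hty (fun i x => bm (front u) i (bm s i x))
  (fun i x => bm (back v) i (bm g i x)) := fsg.
have qis_t' : cqis (raw (bm t')).
  apply: (cqis_first (g := bm (comp_map (back u) s)) (f := bm t')) => //.
  exact: (cqis_hty bbE qs').
have q1 : cqis (fun i x => bm (front w) i (bm s' i x)) by apply: cqis_comp.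
have qvg : cqis (raw (bm (comp_map (front v) g))).
  apply: (cqis_last (g := bm (comp_map (front v) g)) (f := bm t')) => //.
  exact: (cqis_hty ffE q1).
have inj_g : cinj (raw (bm g)).
  by case: qvg => + _; apply: (cinj_first (g := bm (front v)) (f := bm g)).
split; last by case: qvg => _; apply: (csur_last (g := bm (front v)) (f := bm g)).
apply: (cinj_last (g := bm (front u)) (f := bm s)); last by case: qis_s.
have : cinj (fun i x => bm (back v) i (bm g i x)) by apply: cinj_comp => //; case: qbv.
exact: (cinj_hty (hty_sym sgE)).
Qed.

Lemma cqis_id (R : pzRingType) (X : bcomplex R) : cqis (raw (bm (id_map X))).
Proof. exact/quasi_isoE/quasi_iso_id. Qed.

Lemma is_iso_qis (R : pzRingType) (X Y : bcomplex R) (u : roof X Y) :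
  is_iso u -> cqis (raw (bm (front u))).
Proof.
move=> [v [uv vu]]; have [inj_u _] := is_comp_qis uv (cqis_id X).
by have [_ sur_u] := is_comp_qis vu (cqis_id Y).
Qed.

Section ExtBounded.
Variables (R : pzRingType) (noethR : left_noetherian R).

(** Ext^j(X, N) = 0 for all large j, with j = -i. The bound is uniform in N because it will be
    applied to a syzygy that depends on it. *)
Definition ext_bounded (X : bcomplex R) : Prop :=
  exists n : int, forall (i : int) (N : lmodType R) (fgN : fin_gen N), i <= n ->
    Hom_zero X (cshift (- i) (stalk fgN)).

Definition Hom_exact_low (F : cpx R) : Prop :=
  exists n : int, forall (i : int) (N : lmodType R), i <= n -> fin_gen N ->
    Hom_exact F i N.

Lemma ext_boundedP (F : cpx R) b (X : bcomplex R) (q : cmor F (bc X)) :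
  cproj F -> cfg F -> upbd F b -> cqis (raw q) ->
  ext_bounded X <-> Hom_exact_low F.
Proof.
move=> projF fgF bF qis_q; split=> -[n nP]; exists n => i N.
  by move=> ni fgN; apply/(Hom_zero_stalk noethR projF fgF bF qis_q fgN)/nP.
by move=> fgN ni; apply/(Hom_zero_stalk noethR projF fgF bF qis_q fgN)/nP.
Qed.

Lemma resolution_ex (X : bcomplex R) : exists (F : cpx R) b (q : cmor F (bc X)),
  [/\ cproj F, cfg F, upbd F b & strong q].
Proof.
have [b bX] := high_bound X; have [F [q Fq]] := resolution noethR bX.
by exists F, b, q.
Qed.

(** A resolution of the apex resolves both ends, by composition with the two legs. *)
Lemma ext_bounded_iso (X Y : bcomplex R) (u : roof X Y) :
  is_iso u -> ext_bounded X <-> ext_bounded Y.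
Proof.
move=> /is_iso_qis qf; have /quasi_isoE qb := @back_qis _ _ _ u.
have [F [b [q [projF fgF bF /strong_qis qis_q]]]] := resolution_ex (apex u).
rewrite (@ext_boundedP F b X (mcomp (bm (back u)) q)) //; last exact: cqis_comp.
by rewrite (@ext_boundedP F b Y (mcomp (bm (front u)) q)) //; apply: cqis_comp.
Qed.

Lemma ext_bounded_shift n (X : bcomplex R) : ext_bounded X -> ext_bounded (cshift n X).
Proof.
have [F [b [q [projF fgF bF sq]]]] := resolution_ex X.
move=> /(ext_boundedP projF fgF bF (strong_qis sq)) [m mP].
have [p sp] := pshift_strong n sq.
apply/(@ext_boundedP _ (b - n) _ p) => [i|i|i bi||]; [exact: projF | exact: fgF | | |].
- by apply: bF; lia.
- exact: strong_qis.
by exists (m - n) => i N im fgN; apply: pshift_Hom_exact; apply: mP => //; lia.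
Qed.

Lemma ext_bounded_summand (X Y : bcomplex R) :
  ext_bounded (direct_sum X Y) -> ext_bounded X.
Proof.
have [F [b [q [projF fgF bF sq]]]] := resolution_ex X.
have [G [c [p [projG fgG bG sp]]]] := resolution_ex Y.
have [r sr] := psum_strong sq sp.
have eS : ext_bounded (direct_sum X Y) <-> Hom_exact_low (psum F G).
  apply: (@ext_boundedP _ (Num.max b c) _ r) => [i|i|i bi|].
  - exact: projective_prod.
  - exact: fin_gen_prod.
  - by move=> [x y]; rewrite (bF i _ x) ?(bG i _ y) //; lia.
  - exact: strong_qis.
move=> /eS [m mP].
apply/(ext_boundedP projF fgF bF (strong_qis sq)).
by exists m => i N im fgN; apply: (@psum_Hom_exact _ F G); apply: mP.
Qed.

Lemma ext_bounded_cone (X Y : bcomplex R) (f : chain_map X Y) :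
  [/\ ext_bounded X -> ext_bounded Y -> ext_bounded (cone f),
      ext_bounded Y -> ext_bounded (cone f) -> ext_bounded X &
      ext_bounded X -> ext_bounded (cone f) -> ext_bounded Y].
Proof.
have [F [b [q [projF fgF bF sq]]]] := resolution_ex X.
have [G [c [p [projG fgG bG sp]]]] := resolution_ex Y.
have [g gE] := strong_lift (mcomp (bm f) q) projF bF sp.
have [r sr] := pcone_strong gE sq sp.
have eX := ext_boundedP projF fgF bF (strong_qis sq).
have eY := ext_boundedP projG fgG bG (strong_qis sp).
have eC : ext_bounded (cone f) <-> Hom_exact_low (pcone g).
  apply: (@ext_boundedP _ (Num.max b c) _ r) => [i|i|i bi|].
  - exact: projective_prod.
  - exact: fin_gen_prod.
  - by move=> [x y]; rewrite (bF _ _ x) ?(bG i _ y) //; lia.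
  - exact: strong_qis.
(* The cone in degree [i] involves F in degree [i + 1]; the [- 1] makes one bound serve all three
   cases. *)
split; rewrite ?eX ?eY ?eC => -[m mP] [n nP]; exists (Num.min m n - 1) => i N ii fgN.
- by apply: pcone_Hom_exact; [apply: mP | apply: nP] => //; lia.
- rewrite -[i](subrK 1).
  by apply: (pcone_Hom_exact_source (g := g)); [apply: nP | apply: mP] => //; lia.
- by apply: (pcone_Hom_exact_target (g := g)); [apply: mP | apply: nP] => //; lia.
Qed.

Lemma projective_regular : projective (R^o : lmodType R).
Proof.
have [|i iE] := @exists_linear R R^o 'rV[R]_1 (fun c => \row_j c).
  by move=> a x y; apply/rowP => j; rewrite !mxE.
have [|p pE] := @exists_linear R 'rV[R]_1 R^o (fun v => v 0 0).
  by move=> a x y; rewrite !mxE.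
apply: (projective_retract (i := i) (p := p)); last exact: projective_rV.
by move=> x; rewrite pE iE mxE.
Qed.

Lemma projective_stalk (P : lmodType R) : projective P -> forall i, projective (stalk_ob P i).
Proof.
by move=> projP i; rewrite /stalk_ob; case: ifP => // _; apply: projective_rV.
Qed.

Definition cid_mor (A : cpx R) : cmor A A := @Cmor R A A (fun i => idfun) (fun _ _ _ => erefl).

Lemma strong_id (A : cpx R) : strong (cid_mor A).
Proof. by move=> i j z x _ _ /= zx; exists x. Qed.

Lemma ext_bounded_ring : ext_bounded (stalk_ring R).
Proof.
have [b bX] := high_bound (stalk_ring R).
apply/(@ext_boundedP _ b _ (cid_mor (bc (stalk_ring R)))) => //.
- exact: (projective_stalk projective_regular).
- exact: ob_fin_gen.
- exact/strong_qis/strong_id.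
exists (-1) => i N i1 fgN f _; exists 0, \0 => x.
suff -> : x = 0 by rewrite !linear0.
move: x; rewrite /= /stalk_ob ifF; last by apply/negbTE; lia.
by move=> x; apply/rowP => -[].
Qed.

Lemma ext_bounded_thick : thick ext_bounded.
Proof.
split.
- by exists (stalk_ring R); apply: ext_bounded_ring.
- exact: ext_bounded_shift.
- move=> X Y Z u v w [X' [Y' [f [a [b [c [[isoa isob isoc] _]]]]]]].
  have eX := ext_bounded_iso isoa; have eY := ext_bounded_iso isob.
  have eZ := ext_bounded_iso isoc; have [cZ cX cY] := ext_bounded_cone f.
  by split=> [/eX ? /eY ?|/eY ? /eZ ?|/eX ? /eZ ?];
    [apply/eZ/cZ | apply/eX/cX | apply/eY/cY].
- move=> X Y [Y' [u isou]] /(ext_bounded_iso isou).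
  exact: ext_bounded_summand.
Qed.

Lemma Ext_vanishing_fin_proj_dim :
  (forall M : bcomplex R,
     eventually_orthogonal M M -> eventually_orthogonal M (stalk_ring R) ->
     Thick (stalk_ring R) M) ->
  forall M : lmodType R, fin_gen M ->
     (exists n : int, forall i : nat, n <= i%:Z ->
        Ext_zero i M M /\ Ext_zero i M R^o) ->
     fin_proj_dim M.
Proof.
move=> orthThick M fgM [n nP]; pose X := stalk fgM.
have X0 i : i != 0 -> forall x : X i, x = 0.
  move=> i0; rewrite /X /= /stalk_ob ifF; last by apply/negbTE; lia.
  by move=> x; apply/rowP => -[].
have [i i0|F [q [projF fgF bF sq]]] := resolution noethR (X := X) (b := 0).
  by apply: X0; lia.
have qis_q := strong_qis sq.
pose e : {linear F 0 -> M} := q 0.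
have e_surj : surjective e.
  move=> x; have [j||w [_ <-]] := sq 0 1 0 x erefl; rewrite ?linear0 //.
  by exists w.
have e_exact x : e x = 0 <-> cbd x.
  split=> [ex|[j [y <-]]]; last by rewrite /e /= cmE.
  have cx : ccyc x by apply: (@ccyc_next _ _ 0 1); [| apply: bF].
  have [//|w [<- _]] := sq (-1) 0 x 0 erefl cx; last exact: cbd_cd.
have exF i (x : F i) : i < 0 -> ccyc x -> cbd x.
  by move=> i0; apply: (resolution_exact qis_q); apply: X0; lia.
pose P := tail projF e_surj e_exact exF.
have fgP k : fin_gen (res_ob P k) by apply: fgF.
have PE k N : Ext_exact P k.+1 N <-> Hom_exact F (0 - k.+1%:Z) N by apply: tail_Ext_exact.
have orth N (fgN : fin_gen N) :
    (forall i : nat, n <= i%:Z -> Ext_zero i M N) ->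
    eventually_orthogonal X (stalk fgN).
  (* The successor excludes [i = 0], as the tail resolution describes Ext in positive degrees only.
     In the other direction F vanishes. *)
  move=> extN; exists (`|n|.+1)%N => i ni; rewrite -[i]opprK.
  apply/(Hom_zero_stalk noethR projF fgF bF qis_q).
  have [i0|i0] := ltP 0 (- i); first by move=> f _; exists 0, \0 => x; rewrite (bF _ i0 x) !linear0.
  have [k ik] : exists k : nat, - i = 0 - k.+1%:Z.
    by exists (`|i|.-1)%N; lia.
  by rewrite ik; apply/PE/extN; lia.
have [m mP] : ext_bounded X.
  apply: (orthThick X); [| |exact: ext_bounded_thick | exact: ext_bounded_ring].
    by apply: orth => i /nP [].
  by apply: orth => i /nP [].
(* With [k = |m|] the degree [- (k + 1)] is at most [m]. *)
apply: (exact_fin_proj_dim noethR (k := `|m|%N) fgP) => N fgN; apply/PE.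
by apply/(Hom_zero_stalk noethR projF fgF bF qis_q fgN); apply: mP; lia.
Qed.
End ExtBounded.

(** * Thick subcategories and perfect complexes *)

Lemma homotopic_ext (R : pzRingType) (X Y : bcomplex R) (f g : chain_map X Y) :
  (forall i x, f i x = g i x) -> homotopic f g.
Proof. exact: (@hty_ext R (bc X) (bc Y)). Qed.

Lemma quasi_iso_comp (R : pzRingType) (X Y Z : bcomplex R) (g : chain_map Y Z)
    (f : chain_map X Y) : quasi_iso g -> quasi_iso f -> quasi_iso (comp_map g f).
Proof.
move=> /quasi_isoE qg /quasi_isoE qf; apply/quasi_isoE.
exact: (cqis_comp (g := bm g) (f := bm f)).
Qed.

Lemma is_comp_strict (R : pzRingType) (X Y Z : bcomplex R) (f : chain_map X Y)
    (v : roof Y Z) (g : chain_map X (apex v)) (h : chain_map X Z) :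
  (forall i x, back v i (g i x) = f i x) -> (forall i x, front v i (g i x) = h i x) ->
  is_comp (roof_of f) v (roof_of h).
Proof.
move=> bg fg; have qid := quasi_iso_comp (@quasi_iso_id R X) (@quasi_iso_id R X).
exists X, (id_map X), g, qid; split; first by apply: homotopic_ext => i x /=; rewrite bg.
by exists X, (id_map X), (id_map X); split=> //; apply: homotopic_ext => i x /=; rewrite ?fg.
Qed.

Lemma is_comp_inverse (R : pzRingType) (X Y : bcomplex R) (u : roof X Y)
    (qf : quasi_iso (front u)) : is_comp u (Roof (back u) qf) (roof_of (id_map X)).
Proof.
have qb := @back_qis _ _ _ u; have qid := @quasi_iso_id R (apex u).
exists (apex u), (id_map _), (id_map _), (quasi_iso_comp qb qid).
split; first by apply: homotopic_ext.
exists (apex u), (back u), (id_map _); split; first exact: quasi_iso_comp (@quasi_iso_id R X) qb.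
  by apply: homotopic_ext.
by apply: homotopic_ext.
Qed.

Lemma qis_is_iso (R : pzRingType) (X Y : bcomplex R) (u : roof X Y) :
  quasi_iso (front u) -> is_iso u.
Proof.
move=> qf; exists (Roof (back u) qf); split; first exact: is_comp_inverse.
case: u qf => Z s f qs /= qf.
exact: (@is_comp_inverse R Y X (Roof s qf) qs).
Qed.

Lemma distinguished_cone (R : pzRingType) (X Y : bcomplex R) (f : chain_map X Y) :
  distinguished (roof_of f) (roof_of (cone_in f)) (roof_of (cone_out f)).
Proof.
have iso_id Z : is_iso (roof_of (id_map Z)) := qis_is_iso (u := roof_of _) (@quasi_iso_id R Z).
exists X, Y, f, (roof_of (id_map _)), (roof_of (id_map _)), (roof_of (id_map _)).
split; split=> //.
- exists (roof_of f); split; first exact: (@is_comp_strict R _ _ _ _ (roof_of (id_map Y)) f).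
  exact: (@is_comp_strict R _ _ _ _ (roof_of f) (id_map X)).
- exists (roof_of (cone_in f)); split.
    exact: (@is_comp_strict R _ _ _ _ (roof_of (id_map _)) (cone_in f)).
  exact: (@is_comp_strict R _ _ _ _ (roof_of (cone_in f)) (id_map Y)).
- exists (roof_of (cone_out f)); split.
    exact: (@is_comp_strict R _ _ _ _ (roof_shift 1 (roof_of (id_map X))) (cone_out f)).
  exact: (@is_comp_strict R _ _ _ _ (roof_of (cone_out f)) (id_map (cone f))).
Qed.

Lemma bij_qis (R : pzRingType) (X Y : bcomplex R) (f : chain_map X Y) :
  (forall i x, f i x = 0 -> x = 0) -> (forall i, surjective (f i)) -> quasi_iso f.
Proof.
move=> inj_f sur_f; apply/quasi_isoE; split=> i.
  move=> x _ [j [y yE]]; have [z zE] := sur_f j y; exists j, z.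
  apply/eqP; rewrite -subr_eq0; apply/eqP/inj_f.
  by rewrite linearB /= cmap_dif zE [dif _ _ _ _]yE subrr.
move=> y cy; have [x xE] := sur_f i y; exists x; split=> [j|].
  by apply: (inj_f); rewrite cmap_dif xE; apply: cy.
by rewrite /= xE subrr; apply: cbd0.
Qed.

Section SubComplex.
Variables (R : pzRingType) (noethR : left_noetherian R) (X : bcomplex R).
Variables (P : forall i, X i -> Prop) (subP : forall i, submodule (@P i)).
Hypothesis dif_P : forall i j x, P x -> P (dif X i j x).

Let incl_dif i j : {linear sub (subP i) -> X j} := dif X i j \o incl (subP i).

Lemma incl_difP i j x : P (incl_dif i j x).
Proof. by rewrite /=; apply/dif_P/(inclP x). Qed.

Definition subcx_dif i j := sval (cid (sub_factor (subP j) (@incl_difP i j))).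

Lemma subcx_difE i j x : incl (subP j) (subcx_dif i j x) = dif X i j (incl (subP i) x).
Proof. exact: (svalP (cid (sub_factor (subP j) (@incl_difP i j)))). Qed.

Lemma subcx_shape i j : j != i + 1 -> forall x, subcx_dif i j x = 0.
Proof.
by move=> ij x; apply: (incl_inj (hP := subP j)); rewrite subcx_difE dif_shape // linear0.
Qed.

Lemma subcx_dd i j k x : subcx_dif j k (subcx_dif i j x) = 0.
Proof. by apply: (incl_inj (hP := subP k)); rewrite !subcx_difE dif_dif linear0. Qed.

Lemma subcx_bounded : exists n : nat, forall i : int, (n < `|i|)%N ->
  forall x : sub (subP i), x = 0.
Proof.
have [n nP] := ob_bounded X; exists n => i ni x.
by apply: (incl_inj (hP := subP i)); rewrite linear0; apply: nP.
Qed.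

Definition subcx : bcomplex R :=
  BComplex subcx_shape subcx_dd
    (fun i => fin_gen_sub (subP i) noethR (ob_fin_gen X i)) subcx_bounded.

Definition subcx_incl : chain_map subcx X :=
  @ChainMap R subcx X (fun i => incl (subP i)) subcx_difE.
End SubComplex.

Section ThickSubcategory.
Variables (R : pzRingType) (S : bcomplex R -> Prop) (thS : thick S).


Lemma rV0_eq0 (x : 'rV[R]_0) : x = 0.
Proof. by apply/rowP => -[]. Qed.

Definition zero_cx : bcomplex R :=
  @BComplex R (fun=> 'rV[R]_0) (fun i j => \0) (fun _ _ _ _ => erefl)
    (fun _ _ _ _ => erefl) (fun=> fin_gen_rV R 0)
    (ex_intro _ 0%N (fun _ _ => rV0_eq0)).

(** Closure under summands yields closure under isomorphism: X is isomorphic to the sum of Y and a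
    zero complex. *)
Lemma thick_span (X Y Z : bcomplex R) (s : chain_map Z X) (f : chain_map Z Y) :
  quasi_iso s -> quasi_iso f -> S X -> S Y.
Proof.
move=> qs qf; apply: (thick_summand thS); exists zero_cx.
have jE i j (x : Y i) : inl_map 'rV[R]_0 (dif Y i j x) =
    dif (direct_sum Y zero_cx) i j (inl_map 'rV[R]_0 x) by [].
pose inj := @ChainMap R Y (direct_sum Y zero_cx) (fun i => inl_map _) jE.
have qinj : quasi_iso inj.
  apply/quasi_isoE; split=> i.
    by move=> x _ [j [[y z] /(congr1 fst) yx]]; exists j, y; exact: yx.
  move=> [y z] cy; exists y; split=> [j|]; first by case: (cy j).
  rewrite [z]rV0_eq0 subrr; exact: cbd0.
exists (Roof (comp_map inj f) qs); apply: qis_is_iso.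
exact: quasi_iso_comp.
Qed.

Lemma thick_qis (X Y : bcomplex R) (f : chain_map X Y) : quasi_iso f -> S X <-> S Y.
Proof.
move=> qf; have qid := @quasi_iso_id R X.
by split; [apply: thick_span qid qf | apply: thick_span qf qid].
Qed.

(** The map from [cone f] to C induced by [g] is a quasi-isomorphism, so the cone triangle supplies
    the three implications. *)
Lemma thick_ses (A B C : bcomplex R) (f : chain_map A B) (g : chain_map B C) :
  (forall i x, f i x = 0 -> x = 0) -> (forall i x, g i (f i x) = 0) ->
  (forall i y, g i y = 0 -> exists x, f i x = y) -> (forall i, surjective (g i)) ->
  [/\ S A -> S B -> S C, S B -> S C -> S A & S A -> S C -> S B].
Proof.
move=> inj_f gf ex_g sur_g.
pose p2 i : {linear (A (i + 1)%R * B i)%type -> B i} := snd.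
pose h i : {linear cone f i -> C i} := g i \o p2 i.
have hE i j (x : cone f i) : h j (dif (cone f) i j x) = dif C i j (h i x).
  rewrite /= linearD /= cmap_dif; case: x => x y /=; move: (i + 1) x => k x.
  have [<-|kj] := eqVneq k j; first by rewrite transport_id gf add0r.
  by rewrite transport0 // linear0 add0r.
suff qh : quasi_iso (ChainMap hE).
  have hC := thick_qis qh.
  have [cZ cX cY] := thick_triangle thS (distinguished_cone f).
  by split=> [? ?|? /hC ?|? /hC ?]; [apply/hC/cZ | apply: cX | apply: cY].
apply/quasi_isoE; split=> i.
  move=> [a b] cab; have := cab (i + 1); rewrite /= /cone_dif /= transport_id.
  move=> [/eqP]; rewrite oppr_eq0 => /eqP da db.
  move=> /(cbd_prev (esym (subrK 1 i))) [c /= gbE].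
  (* Subtracting the coboundary of a lift [b'] of [c] moves [b] into the image of [f]; its preimage
     [a'] bounds [a] up to sign. *)
  have [b' b'E] := sur_g (i - 1) c.
  have [|a' a'E] := ex_g i (b - dif B (i - 1) i b').
    by rewrite linearB /= cmap_dif b'E gbE subrr.
  have aE : a = - dif A i (i + 1) a'.
    apply/eqP; rewrite -subr_eq0 opprK; apply/eqP/inj_f.
    rewrite linearD /= cmap_dif a'E linearB /= dif_dif subr0; exact: db.
  exists (i - 1), (transport A (i - 1 + 1) a', b'); rewrite /= /cone_dif /=.
  move: (i - 1 + 1) (subrK 1 i) => k ->; rewrite !transport_id a'E -aE.
  by rewrite subrK.
move=> c cc; have [b bE] := sur_g i c.
have [|a aE] := ex_g (i + 1) (dif B i (i + 1) b).
  by rewrite cmap_dif bE; apply: cc.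
exists (- a, b); split; last by rewrite /= bE subrr; apply: cbd0.
apply: (@ccyc_next _ (bc (cone f)) _ (i + 1)) => //.
rewrite /= /cone_dif /= transport_id !linearN /= aE addNr opprK.
congr (_, _); apply: (inj_f); rewrite cmap_dif aE dif_dif.
by [].
Qed.

(** Two out of three for 0 -> Y -> Y -> X -> 0, with any Y in the class. *)
Lemma thick_zero (X : bcomplex R) : (forall i (x : X i), x = 0) -> S X.
Proof.
move=> X0; have [Y SY] := thick_nonempty thS.
have [//|i x|i y _|i x|h _ _] := @thick_ses Y Y X (id_map Y) (zero_map Y X).
- by [].
- by exists y.
- by exists 0; rewrite (X0 i x).
exact: h.
Qed.

Definition stalk_map_fun (A B : lmodType R) (f : {linear A -> B}) i :
    {linear stalk_ob A i -> stalk_ob B i} :=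
  @transport R (stalk_ob B) 0 i \o
    (f : {linear stalk_ob A 0 -> stalk_ob B 0}) \o @transport R (stalk_ob A) i 0.

Lemma stalk_map_dif (A B : lmodType R) (fgA : fin_gen A) (fgB : fin_gen B)
    (f : {linear A -> B}) i j (x : stalk fgA i) :
  stalk_map_fun f j (dif (stalk fgA) i j x) = dif (stalk fgB) i j (stalk_map_fun f i x).
Proof. by rewrite [dif _ _ _ x]/= linear0. Qed.

Definition stalk_map (A B : lmodType R) (fgA : fin_gen A) (fgB : fin_gen B)
    (f : {linear A -> B}) : chain_map (stalk fgA) (stalk fgB) :=
  @ChainMap R (stalk fgA) (stalk fgB) (stalk_map_fun f) (@stalk_map_dif A B fgA fgB f).

Lemma stalk_off (A : lmodType R) i (x : stalk_ob A i) : i != 0 -> x = 0.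
Proof. by move=> i0; move: x; rewrite /stalk_ob ifF; [exact: rV0_eq0 | apply/negbTE]. Qed.

Lemma thick_stalk_ses (A B C : lmodType R) (fgA : fin_gen A) (fgB : fin_gen B)
    (fgC : fin_gen C) (f : {linear A -> B}) (g : {linear B -> C}) :
  (forall x, f x = 0 -> x = 0) -> (forall x, g (f x) = 0) ->
  (forall y, g y = 0 -> exists x, f x = y) -> surjective g ->
  S (stalk fgA) -> S (stalk fgC) -> S (stalk fgB).
Proof.
move=> inj_f gf ex_g sur_g.
have [i x|i x|i y|i x|_ _ //] := @thick_ses _ _ _ (stalk_map fgA fgB f) (stalk_map fgB fgC g).
- have [i0|i0] := eqVneq i 0; last by rewrite [x](stalk_off _ i0).
  by move: x; rewrite i0 => x; rewrite /= /stalk_map_fun /= !transport_id; apply: inj_f.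
- have [i0|i0] := eqVneq i 0; last by rewrite [LHS](stalk_off _ i0).
  by move: x; rewrite i0 => x; rewrite /= /stalk_map_fun /= !transport_id; apply: gf.
- have [i0|i0] := eqVneq i 0.
    by move: y; rewrite i0 => y; rewrite /= /stalk_map_fun /= !transport_id => /ex_g [x <-];
      exists x; rewrite !transport_id.
  by move=> _; exists 0; rewrite linear0 [y](stalk_off _ i0).
- have [i0|i0] := eqVneq i 0.
    move: x; rewrite i0 => x; have [y yE] := sur_g x.
    by exists y; rewrite /= /stalk_map_fun /= !transport_id.
  by exists 0; rewrite linear0 [x](stalk_off _ i0).
Qed.

Hypothesis SR : S (stalk_ring R).

Lemma thick_stalk_rV n (fgV : fin_gen ('rV[R]_n : lmodType R)) : S (stalk fgV).
Proof.
elim: n fgV => [|n IHn] fgV.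
  apply: thick_zero => i x; have [i0|] := eqVneq i 0; last exact: stalk_off.
  by move: x; rewrite i0 => x; apply: rV0_eq0.
have [|f fE] := @exists_linear R R^o 'rV[R]_n.+1 (fun c => \row_j (if j == 0 then c else 0)).
  move=> a x y; apply/rowP => j; rewrite !mxE; case: ifP => //.
  by rewrite mulr0 addr0.
have [|g gE] := @exists_linear R 'rV[R]_n.+1 'rV[R]_n (fun v => \row_j v 0 (lift ord0 j)).
  by move=> a x y; apply/rowP => j; rewrite !mxE.
apply: (@thick_stalk_ses _ _ _ (fin_gen_regular R) fgV (fin_gen_rV R n) f g _ _ _ _ SR (IHn _)).
- by move=> x; rewrite fE => /rowP/(_ 0); rewrite !mxE.
- by move=> x; rewrite gE fE; apply/rowP => j; rewrite !mxE.
- move=> y; rewrite gE => /rowP gy; exists (y 0 0); rewrite fE; apply/rowP => j.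
  rewrite !mxE; case: (unliftP ord0 j) => [k ->|->]; last by rewrite eqxx.
  by have := gy k; rewrite !mxE.
- move=> x; exists (\row_j (if unlift ord0 j is Some k then x 0 k else 0)).
  by rewrite gE; apply/rowP => j; rewrite !mxE liftK.
Qed.

(** R^n is the direct sum of P and the kernel K of [p]. The isomorphism is [(p, t)], where [t] is
    [1 - s p] with values in K. *)
Lemma thick_stalk_projective (noethR : left_noetherian R) (P : lmodType R) (fgP : fin_gen P) :
  projective P -> S (stalk fgP).
Proof.
move=> projP; have [n [g gP]] := fgP.
have [|s sK] := projective_section (f := lincomb g : {linear _ -> _}) projP.
  by move=> x; apply/inspan_lincomb/gP.
pose p : {linear 'rV[R]_n -> P} := lincomb g; pose K := submodule_ker p.
have [x|t tE] := @sub_factor _ _ _ K _ (idfun \- (s \o p) : {linear 'rV[R]_n -> 'rV[R]_n}).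
  by rewrite /= linearB /= sK subrr.
have fgK := fin_gen_sub K noethR (fin_gen_rV R n).
apply: (thick_summand thS) (thick_stalk_rV (fin_gen_rV R n)).
exists (stalk fgK).
pose u := stalk_map (fin_gen_rV R n) fgP p; pose v := stalk_map (fin_gen_rV R n) fgK t.
pose D := direct_sum (stalk fgP) (stalk fgK).
pose h i : {linear stalk (fin_gen_rV R n) i -> D i} :=
  (@inl_map R _ (stalk fgK i) \o u i) \+ (@inr_map R (stalk fgP i) _ \o v i).
have hE i x : h i x = (u i x, v i x).
  by rewrite [h i x]surjective_pairing /= addr0 add0r.
have hdif i j (x : stalk (fin_gen_rV R n) i) :
    h j (dif (stalk (fin_gen_rV R n)) i j x) = dif D i j (h i x).
  by rewrite [dif (stalk _) i j x]/= linear0.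
exists (roof_of (ChainMap hdif)); apply/qis_is_iso/bij_qis => i.
  move=> x; rewrite [cmap _ _ _]hE => -[].
  have [i0|i0] := eqVneq i 0; last by rewrite [x](stalk_off _ i0).
  move: x; rewrite i0 => x; rewrite /= /stalk_map_fun /= !transport_id => px tx.
  have := tE x; rewrite tx linear0 /=.
  by rewrite px linear0 subr0.
move=> [y z]; have [i0|i0] := eqVneq i 0; last first.
  by exists 0; rewrite [cmap _ _ _]hE !linear0 [y](stalk_off _ i0) [z](stalk_off _ i0).
move: y z; rewrite i0 => y z; exists (s y + incl K z : 'rV[R]_n).
have pz : p (incl K z) = 0 := inclP z.
rewrite [cmap _ _ _]hE /= /stalk_map_fun /= !transport_id; congr (_, _).
  by rewrite linearD /= -/p sK -[lincomb g _]/(p _) pz addr0.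
apply: (@incl_inj _ _ _ K); rewrite tE /=.
have -> : lincomb g (s y + incl K z) = y.
  by rewrite linearD /= sK -[lincomb g (incl K z)]/(p _) pz addr0.
by rewrite addrC addKr.
Qed.

(** Induction on the length of an interval starting at [a] that supports X, by brutal truncation:
    the terms above [a] form a subcomplex [K], and the quotient is the stalk of X^a in degree
    [a]. *)
Lemma thick_perfect (noethR : left_noetherian R) (X : bcomplex R) :
  (forall i, projective (X i)) -> S X.
Proof.
have [m Xm] := low_bound X; have [b Xb] := high_bound X.
move: (- m%:Z) Xm => a Xa.
have [n bn] : exists n : nat, b < a + n%:Z by exists `|b - a|.+1; lia.
have {Xb bn} Xb i : a + n%:Z <= i -> forall x : X i, x = 0 by move=> ni; apply: Xb; lia.
elim: n a X Xa Xb => [|n IHn] a X Xa Xb projX.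
  by apply: thick_zero => i; have [ia|ai] := ltP i a; [apply: Xa | apply: Xb; lia].
pose P i (x : X i) := i <= a -> x = 0.
have subP i : submodule (@P i) by apply/submodule_imp/submodule0.
have dP i j x : P i x -> P j (dif X i j x).
  move=> Px ja; have [ij|ij] := eqVneq j (i + 1); last exact: dif_shape.
  by rewrite Px ?linear0 //; lia.
pose K := subcx noethR subP dP.
have SK : S K.
  apply: (IHn (a + 1)) => i; last first.
  - have [ia|ai] := leP i a.
      move=> A B g f _; exists \0 => x; suff -> : x = 0 by rewrite !linear0.
      by apply: (incl_inj (hP := subP i)); rewrite linear0; apply: (inclP x).
    have [x|h hE] := @sub_factor _ _ _ (subP i) _ (idfun : {linear X i -> X i}).
      by rewrite /P; lia.
    apply: (@projective_retract _ _ _ (incl (subP i)) h) (projX i) => x.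
    by apply: (incl_inj (hP := subP i)); rewrite hE.
  - move=> ia x; apply: (incl_inj (hP := subP i)); rewrite linear0.
    by apply: Xb; lia.
  - move=> ia x; apply: (incl_inj (hP := subP i)); rewrite linear0.
    by apply: (inclP x); lia.
pose T := cshift (- a) (stalk (ob_fin_gen X a)).
have ST : S T by apply/(thick_shift thS)/thick_stalk_projective.
have dT i j (x : T i) : dif T i j x = 0 by rewrite /T /= shift_difE /= scaler0.
have T0 i : i != a -> forall x : T i, x = 0.
  by move=> ia x; apply: stalk_off; lia.
pose g i : {linear X i -> T i} :=
  @transport R (stalk_ob (X a)) 0 (i - a) \o @transport R X i a.
have gE i j (x : X i) : g j (dif X i j x) = dif T i j (g i x).
  rewrite dT; have [ja|ja] := eqVneq j a; last exact: T0.
  have [ij|ij] := eqVneq j (i + 1); last by rewrite dif_shape // linear0.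
  by rewrite [x]Xa ?linear0 //; lia.
have gK i (x : X i) : i = a -> g i x = 0 -> x = 0.
  move=> ia; move: x; rewrite {}ia => x; rewrite /g /= transport_id.
  by move: (a - a) (subrr a) => z ->; rewrite transport_id.
have [||||_ _ h] := @thick_ses K X T (subcx_incl noethR subP dP) (ChainMap gE).
- by move=> i x xE; apply: (incl_inj (hP := subP i)); rewrite linear0.
- move=> i x; have [ia|ia] := eqVneq i a; last exact: T0.
  by rewrite /= (inclP x) ?linear0 // ia.
- move=> i x gx; apply: incl_ex => ia.
  have [ia'|ia'] := eqVneq i a; first exact: gK gx.
  by apply: Xa; lia.
- move=> i y; have [ia|ia] := eqVneq i a; last by exists 0; rewrite linear0 [y]T0.
  move: y; rewrite {}ia => y.
  exists (@transport R (stalk_ob (X a)) (a - a) 0 y); rewrite /= /g /= transport_id.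
  by move: y; rewrite /T /=; move: (a - a) (subrr a) => z ->  y; rewrite !transport_id.
exact: h.
Qed.
End ThickSubcategory.

(** * Eventually self-orthogonal complexes *)

(** A dual basis of P splits [f] into coordinates with values in R, each of which factors through
    the differential. *)
Lemma Hom_exact_projective (R : pzRingType) (F : cpx R) i (P : lmodType R) :
  fin_gen P -> projective P -> Hom_exact F i R^o -> Hom_exact F i P.
Proof.
move=> fgP projP exR f fd; have [n [c [g gE]]] := projective_dual_basis fgP projP.
have ex k : exists d : {linear F (i + 1) -> R^o}, forall x, c k (f x) = d (cd F i (i + 1) x).
  apply: (@Hom_exact_next R F i (i + 1) R^o (c k \o f : {linear _ -> _})) => //.
  by move=> j x; rewrite /= fd linear0.
have /all_sig [d dE] := fun k => cid (ex k).
have [|h hE] := @exists_linear R (F (i + 1)) P (fun x => \sum_(k < n) (d k x : R) *: g k).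
  move=> a x y; rewrite scaler_sumr -big_split; apply: eq_bigr => k _ /=.
  by rewrite linearP scalerDl scalerA.
by exists (i + 1), h => x; rewrite hE [LHS]gE; apply: eq_bigr => k _; rewrite dE.
Qed.

Lemma Hom_exact_zero (R : pzRingType) (F : cpx R) i (N : lmodType R) :
  (forall x : N, x = 0) -> Hom_exact F i N.
Proof. by move=> N0 f _; exists i, \0 => x; rewrite (N0 (f x)). Qed.

Lemma projective_zero (R : pzRingType) (P : lmodType R) :
  (forall x : P, x = 0) -> projective P.
Proof. by move=> P0 A B g f _; exists \0 => x; rewrite (P0 x) !linear0. Qed.

(** Obstruction theory: [d g] on F^k is a cocycle with values in Y^(k+1), and exactness turns it
    into the next component. The map is zero below degree [i], and finitely many steps reach the
    degrees where Y vanishes. *)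
Lemma extend_cocycle (R : pzRingType) (F : cpx R) (Y : bcomplex R) i
    (f : {linear F i -> Y i}) :
  (forall j (x : F j), f (cd F j i x) = 0) ->
  (forall k, i <= k -> Hom_exact F k (Y (k + 1))) ->
  exists g : cmor F (bc Y), forall x, g i x = f x.
Proof.
move=> fd exF; have [c cY] := high_bound Y.
pose chain (g : forall k, {linear F k -> Y k}) k := forall x,
  dif Y k (k + 1) (g k x) = g (k + 1) (cd F k (k + 1) x).
suff ext (t : nat) : exists g : forall k, {linear F k -> Y k},
    (forall x, g i x = f x) /\ forall k : int, k < i + t%:Z -> chain g k.
  have [g [gf gP]] := ext (`|c - i|.+1)%N.
  suff gE k j x : g j (cd F k j x) = cd (bc Y) k j (g k x).
    by exists (@Cmor R F (bc Y) g gE).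
  have [->|jk] := eqVneq j (k + 1); last by rewrite !cd_shape ?linear0.
  have [kt|tk] := ltP k (i + (`|c - i|.+1)%N%:Z); first by rewrite gP.
  by rewrite [LHS]cY ?[RHS]cY //; lia.
elim: t => [|t [g [gf gP]]].
  exists (dfwith (fun k => \0 : {linear F k -> Y k}) f).
  split=> [x|k ki x]; first by rewrite dfwith_in.
  rewrite dfwith_out ?linear0; last by lia.
  have [ki'|ki'] := eqVneq i (k + 1); last by rewrite dfwith_out.
  by rewrite -ki' dfwith_in fd.
pose k := i + t%:Z.
have [||h hE] := @Hom_exact_next R F k (k + 1) (Y (k + 1))
    (dif Y k (k + 1) \o g k : {linear _ -> _}) erefl.
- by apply: exF; lia.
- move=> j x; have [jk|jk] := eqVneq k (j + 1); last by rewrite cd_shape ?linear0.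
  rewrite /= jk -gP ?dif_dif //; lia.
exists (dfwith g h); split=> [x|j jt]; first by rewrite dfwith_out //; lia.
rewrite /chain; have [jk|jk] := eqVneq j k.
  by rewrite jk => x; rewrite dfwith_in dfwith_out -?hE //; lia.
by move=> x; rewrite !dfwith_out; [apply: gP | |]; lia.
Qed.

Section TruncationTerms.
Variables (R : pzRingType) (noethR : left_noetherian R).
Variables (F : cpx R) (a b : int) (fgF : cfg F) (bF : upbd F b).
Hypothesis projF : cproj F.
Let W := trunc noethR a fgF bF.
Notation tv := (incl (trunc_submodule _ _ _)).

(** Above degree [a] the first component embeds W^i in F^i, and the canonical projection retracts
    F^i onto it. *)
Lemma trunc_projective i : a < i -> projective (W i).
Proof.
move=> ai; pose p1 : {linear (F i * F (i + 1)%R)%type -> F i} := fst.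
apply: (@projective_retract _ _ _ (p1 \o tv) (trunc_can noethR a fgF bF i)) (@projF i) => x.
apply: (@incl_inj _ _ _ (trunc_submodule F a i)).
have [_ [x2 _]] := inclP x; rewrite trunc_canE /= [RHS]surjective_pairing x2; last lia.
by rewrite !ifF //; apply/negbTE; lia.
Qed.

Hypothesis exF : forall z : F (a + 1), ccyc z -> cbd z.

Lemma trunc_lift (w : W a) : exists y : F a, cd F a (a + 1) y = (tv w).2 /\
  trunc_can noethR a fgF bF a y = w.
Proof.
have [w1 [_ dw]] := inclP w.
have /(cbd_prev erefl) [y yE] := exF dw; exists y; split=> //.
apply: (@incl_inj _ _ _ (trunc_submodule F a a)).
by rewrite trunc_canE lexx eqxx yE [RHS]surjective_pairing w1.
Qed.

(** The projection F^a -> W^a kills coboundaries since W vanishes below [a]. Its factorization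
    through the differential retracts F^(a+1) onto W^a, embedded there by the second component. *)
Lemma trunc_bottom_projective : Hom_exact F a (W a) -> projective (W a).
Proof.
move=> exW; have [|g gE] := @Hom_exact_next R F a (a + 1) (W a)
    (trunc_can noethR a fgF bF a) erefl exW.
  move=> j x; rewrite cmE; have [ja|ja] := eqVneq a (j + 1); last by rewrite cd_shape.
  by rewrite [trunc_can _ _ _ _ _ _]trunc_low ?linear0 //; lia.
pose p2 : {linear (F a * F (a + 1)%R)%type -> F (a + 1)} := snd.
apply: (@projective_retract _ _ _ (p2 \o tv) g) (@projF (a + 1)) => w.
by have [y [yd yw]] := trunc_lift w; rewrite -[RHS]yw gE yd.
Qed.
End TruncationTerms.

Section SelfOrthogonal.
Variables (R : pzRingType) (noethR : left_noetherian R).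

Lemma truncation_qis (F : cpx R) a b (fgF : cfg F) (bF : upbd F b) (X : bcomplex R)
    (q : cmor F (bc X)) :
  (forall i : int, i <= a + 1 -> forall x : X i, x = 0) -> cqis (raw q) ->
  exists p : chain_map (trunc noethR a fgF bF) X, quasi_iso p.
Proof.
move=> X0 qis_q; have X0' i : i <= a -> forall x : X i, x = 0 by move=> ia; apply: X0; lia.
have exF (z : F (a + 1)) : ccyc z -> cbd z by apply: (resolution_exact qis_q); apply: X0.
have [p pE] := trunc_map noethR fgF bF exF q X0'; exists p; apply/quasi_isoE.
by refine (cqis_hty _ (trunc_qis noethR fgF bF X0' qis_q)); apply: hty_ext => i x; rewrite /= pE.
Qed.

Lemma orthogonal_thick (M : bcomplex R) :
  (forall M : lmodType R, fin_gen M ->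
     (exists n : int, forall i : nat, n <= i%:Z ->
        Ext_zero i M M /\ Ext_zero i M R^o) ->
     fin_proj_dim M) ->
  eventually_orthogonal M M -> eventually_orthogonal M (stalk_ring R) ->
  Thick (stalk_ring R) M.
Proof.
move=> ExtFin [n1 MM] [n0 MR] S thS SR.
have [F [b [q [projF fgF bF sq]]]] := resolution_ex noethR M.
have qis_q := strong_qis sq.
(* Degree [a + 1] lies below the support of M, so F is exact in all degrees up to [a + 1]. *)
have [m Mm] := low_bound M; pose a : int := - m%:Z - 2.
have M0 i : i <= a + 1 -> forall x : M i, x = 0 by move=> ia; apply: Mm; rewrite /a in ia; lia.
have exF i (x : F i) : i <= a + 1 -> ccyc x -> cbd x.
  by move=> ia; apply: (resolution_exact qis_q); apply: M0.
pose W := trunc noethR a fgF bF.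
have [p qis_p] : exists p : chain_map W M, quasi_iso p := truncation_qis fgF bF M0 qis_q.
pose N : lmodType R := W a; have fgN : fin_gen N := ob_fin_gen W a.
have exR i : i <= - n0%:Z -> Hom_exact F i R^o.
  move=> i0; apply/(Hom_zero_stalk noethR projF fgF bF qis_q (fin_gen_regular R)).
  by apply: MR; lia.
have [c Wc] := high_bound W.
(* For [i <= i1], the first entry puts every [k] with [k + 1 + (a - i) <= c] into the range of
   [exR]; the second gives [n1 <= a - i], so that [MM] applies to the shift by [a - i]. *)
pose i1 : int := Num.min (- n0%:Z - c + a) (a - n1%:Z).
have exN i : i <= i1 -> Hom_exact F i N.
  (* This shift puts the bottom term N of W in degree [i]. *)
  move=> ii f fd; pose j : int := a - i; pose Y := cshift j W.
  have ija : i + j = a by rewrite /j; lia.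
  pose f' : {linear F i -> Y i} := @transport R W a (i + j) \o f.
  have [k x|k ik|g gE] := @extend_cocycle R F Y i f'.
  - by rewrite /f' /= fd linear0.
  - have [kc|ck] := leP (k + 1 + j) c; last by apply: Hom_exact_zero; apply: Wc.
    apply: Hom_exact_projective; first exact: ob_fin_gen.
      by apply: trunc_projective => //; lia.
    by apply: exR; rewrite /i1 in ii; lia.
  have qis_s : cqis (raw (bm (shift_map j p))).
    exact/quasi_isoE/quasi_iso_shift.
  (* Composed with the quasi-isomorphism from Y to the shift of M, [g] is null-homotopic, and the
     quasi-isomorphism can be cancelled. *)
  have MY := MM j; have {}MY : Hom_zero M (cshift j M) by apply: MY; rewrite /i1 in ii; lia.
  have n_sg := Hom_zero_null noethR projF fgF bF qis_q MY (mcomp (bm (shift_map j p)) g).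
  have [h hE] := null_cancel_qis projF bF qis_s n_sg.
  exists (i + 1), (@transport R W (i + j) a \o h (i + 1) i : {linear _ -> _}) => x.
  (* One term of the homotopy formula passes through W^(a-1) = 0; the other is a factorization of
     [f] through F^(i+1). *)
  have := hE i x; rewrite subr0 gE [h i (i - 1) x]trunc_low; last lia.
  rewrite linear0 add0r /= => <-.
  rewrite /f' /=; move: (i + j) ija => k ->.
  by rewrite !transport_id.
pose e : {linear F a -> N} := trunc_can noethR a fgF bF a.
have exa1 (z : F (a + 1)) : ccyc z -> cbd z by apply: exF.
have e_surj : surjective e.
  by move=> w; have [y [_ yw]] := trunc_lift (noethR := noethR) (fgF := fgF) (bF := bF) exa1 w; exists y.
have e_exact x : e x = 0 <-> cbd x.
  split=> [ex|[l [y <-]]].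
    apply: exF; first lia.
    have := congr1 (fun w => (incl (trunc_submodule F a a) w).2) ex.
    by rewrite trunc_canE eqxx linear0 => dx; apply: ccyc_next dx.
  apply: (@incl_inj _ _ _ (trunc_submodule F a a)).
  by rewrite trunc_canE lexx eqxx cd_cd linear0.
have exlow i (x : F i) : i < a -> ccyc x -> cbd x by move=> ia; apply: exF; lia.
pose P := tail projF e_surj e_exact exlow.
have PE k L : Ext_exact P k.+1 L <-> Hom_exact F (a - k.+1%:Z) L by apply: tail_Ext_exact.
have [] : exists n2 : nat, forall k L, (n2 <= k)%N -> Ext_exact P k.+1 L.
  apply/fin_proj_dim_exact/ExtFin => //.
  (* The entry 1 excludes Ext in degree 0; the other two bring [a - (k + 1)] into the ranges of
     [exN] and [exR]. *)
  exists (Num.max 1 (Num.max (a - i1) (a + n0%:Z))) => -[|k] ki; first lia.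
  split; apply: (Ext_zeroP (P := P)); apply/PE.
    by apply: exN; lia.
  by apply: exR; lia.
(* The term of [P] in degree [n2 + 1] is F in degree [a'], so [exP] makes the bottom term of the
   truncation at [a'] projective. *)
move=> n2 exP; pose a' : int := a - n2.+1%:Z.
have M0' i : i <= a' + 1 -> forall x : M i, x = 0 by move=> ia; apply: M0; rewrite /a' in ia; lia.
have [p' qis_p'] := truncation_qis fgF bF M0' qis_q.
apply/(thick_qis thS qis_p')/(thick_perfect thS SR noethR) => i.
have [ia|ai|ia] := ltgtP i a'.
- by apply: projective_zero => x; apply: trunc_low.
- exact: trunc_projective.
rewrite ia; apply: trunc_bottom_projective => //.
  by move=> z; apply: exF; rewrite /a'; lia.
by apply/PE/exP.
Qed.
End SelfOrthogonal.

Theorem theorem3p4 (R : pzRingType) (noethR : left_noetherian R) :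
  (forall M : lmodType R, fin_gen M ->
     (exists n : int, forall i : nat, n <= i%:Z ->
        Ext_zero i M M /\ Ext_zero i M R^o) ->
     fin_proj_dim M)
  <->
  (forall M : bcomplex R,
     eventually_orthogonal M M -> eventually_orthogonal M (stalk_ring R) ->
     Thick (stalk_ring R) M).
Proof.
split=> [ExtFin M|]; first exact: orthogonal_thick.
exact: Ext_vanishing_fin_proj_dim.
Qed.
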